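(* Let $\zeta\in\mathcal{S}^1$ be a direction, and let $f:\mathbb{T}^2\to\mathbb{R}$ be a toral Laplace eigenfunction, i.e. $f\not\equiv 0$ and $-\Delta f=Ef$ for some $E>0$. Let $\mathcal{A}_\zeta(f)=\{x\in\mathbb{T}^2:\ f(x)=0,\ \langle\nabla f(x),\zeta^\perp\rangle=0\}$. Then: (1) If $\zeta$ is rational, then the set $\mathcal{A}_\zeta(f)$ consists of at most $\frac{\sqrt{E}}{\pi h(\zeta)}$ closed geodesics orthogonal to $\zeta$, at most $\frac{2}{\pi^2}\cdot E$ nonsingular points not lying on these geodesics, and, possibly, singular points of the nodal set $f^{-1}(0)$. (2) If $\zeta$ is not rational, then the set $\mathcal{A}_\zeta(f)$ consists of at most $\frac{2}{\pi^2}\cdot E$ nonsingular points and, possibly, singular points of the nodal set $f^{-1}(0)$. (3) In particular, if $\mathcal{A}_\zeta(f)$ does not contain a closed geodesic, then $N_\zeta(f)\le \frac{2}{\pi^2}\cdot E$.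
   Context: $\mathbb{T}^2=\mathbb{R}^2/\mathbb{Z}^2$ is the standard flat torus, $\mathcal{S}^1\subset\mathbb{R}^2$ is the unit circle, and $\zeta^\perp$ denotes a unit vector orthogonal to $\zeta$. Eigenfunctions are real-valued. A zero $x$ of $f$ is singular if $\nabla f(x)=0$ and nonsingular if $\nabla f(x)\neq 0$. $N_\zeta(f)=\#\{x\in\mathbb{T}^2:\ f(x)=0,\ \nabla f(x)\ne 0,\ \nabla f(x)/\|\nabla f(x)\|=\pm\zeta\}$, the number (possibly infinite) of nonsingular points on the nodal line whose normal is in direction $\pm\zeta$. A direction $\zeta\in\mathcal{S}^1$ is rational if it is a (real) multiple of an integer vector. For rational $\zeta$, its height is $h(\zeta)=\max(|k_1|,|k_2|)$, where $(k_1,k_2)\in\mathbb{Z}^2$ is the primitive integer vector (unique up to sign) with $\zeta=\pm (k_1,k_2)/\sqrt{k_1^2+k_2^2}$. A closed geodesic in $\mathbb{T}^2$ is the image in $\mathbb{T}^2$ of a straight line in $\mathbb{R}^2$ with rational direction; it is orthogonal to $\zeta$ if the line is orthogonal to $\zeta$. *)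

(* Defs.v *)
From HB Require Import structures.
From mathcomp Require Import all_boot all_order all_algebra.
From mathcomp Require Import generic_quotient ring_quotient.
From mathcomp Require Import all_classical all_reals all_analysis.

Set Implicit Arguments.
Unset Strict Implicit.
Unset Printing Implicit Defensive.

Import Order.TTheory GRing.Theory Num.Theory.
Import numFieldNormedType.Exports.

Local Open Scope classical_set_scope.
Local Open Scope quotient_scope.
Local Open Scope ring_scope.

Definition int_lattice (R : realType) : {pred 'rV[R]_2} :=
  [pred x | x \is a mxOver Num.int].

Lemma int_lattice_zmod_closed (R : realType) : zmod_closed (@int_lattice R).
Proof.
split=> [|x y]; rewrite -!topredE /= /int_lattice.
  by apply/mxOverP => i j; rewrite mxE; exact: Num.Theory.int_num0.
move=> /mxOverP xZ /mxOverP yZ; apply/mxOverP => i j.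
by rewrite !mxE rpredB.
Qed.

HB.instance Definition _ (R : realType) :=
  GRing.isZmodClosed.Build 'rV[R]_2 (@int_lattice R)
    (@int_lattice_zmod_closed R).

Definition torus (R : realType) := @Quotient.quot 'rV[R]_2 (@int_lattice R).

HB.instance Definition _ (R : realType) := GRing.Zmodule.on (torus R).
HB.instance Definition _ (R : realType) := EqQuotient.on (torus R).

(* The norm on matrices in the library is the sup norm, hence the explicit
   Euclidean structure. *)
Definition dot (R : realType) (u v : 'rV[R]_2) : R :=
  \sum_(i < 2) u 0 i * v 0 i.

Definition enorm (R : realType) (u : 'rV[R]_2) : R := Num.sqrt (dot u u).

Definition direction (R : realType) (u : 'rV[R]_2) : Prop := enorm u = 1.

Definition pderiv (R : realType) (i : 'I_2) (F : 'rV[R]_2 -> R) :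
  'rV[R]_2 -> R := fun x => 'D_(delta_mx 0 i) F x.

Definition C1 (R : realType) (F : 'rV[R]_2 -> R) : Prop :=
  forall i : 'I_2,
    (forall x, derivable F x (delta_mx 0 i)) /\ continuous (pderiv i F).

Definition C2 (R : realType) (F : 'rV[R]_2 -> R) : Prop :=
  C1 F /\ forall i : 'I_2, C1 (pderiv i F).

Definition lift_torus (R : realType) (f : torus R -> R) : 'rV[R]_2 -> R :=
  fun x => f (\pi_(torus R) x).

(* Derivatives on the torus are those of the Z^2-periodic lift, which do not
   depend on the representative [repr x] of the class [x]. *)
Definition grad (R : realType) (f : torus R -> R) (x : torus R) : 'rV[R]_2 :=
  \row_i pderiv i (lift_torus f) (repr x).

Definition laplacian (R : realType) (f : torus R -> R) (x : torus R) : R :=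
  \sum_(i < 2) pderiv i (pderiv i (lift_torus f)) (repr x).

Definition laplace_eigenfunction (R : realType) (f : torus R -> R) (E : R) :
  Prop :=
  [/\ C2 (lift_torus f), exists x, f x != 0 &
      forall x, - laplacian f x = E * f x].

Definition singular_zeros (R : realType) (f : torus R -> R) : set (torus R) :=
  [set x | f x = 0 /\ grad f x = 0].

Definition nonsingular_zeros (R : realType) (f : torus R -> R) :
  set (torus R) :=
  [set x | f x = 0 /\ grad f x <> 0].

(* [w] plays the role of a unit vector orthogonal to zeta. *)
Definition A_set (R : realType) (w : 'rV[R]_2) (f : torus R -> R) :
  set (torus R) :=
  [set x | f x = 0 /\ dot (grad f x) w = 0].

Definition N_count (R : realType) (zeta : 'rV[R]_2) (f : torus R -> R) :
  \bar R :=
  counting [set x | [/\ f x = 0, grad f x <> 0 &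
    (enorm (grad f x))^-1 *: grad f x = zeta \/
    (enorm (grad f x))^-1 *: grad f x = - zeta]].

Definition int_vec (R : realType) (k : 'rV[int]_2) : 'rV[R]_2 :=
  map_mx intr k.
Arguments int_vec : clear implicits.

Definition rational_direction (R : realType) (zeta : 'rV[R]_2) : Prop :=
  direction zeta /\
  exists (c : R) (k : 'rV[int]_2), zeta = c *: int_vec R k.

Definition primitive_vec (k : 'rV[int]_2) : Prop :=
  coprimez (k 0 ord0) (k 0 ord_max).

(* For a rational direction the set below is a singleton; the default value 0
   is only reached for other vectors. *)
Definition height (R : realType) (zeta : 'rV[R]_2) : nat :=
  xget 0%N [set h | exists k : 'rV[int]_2,
    [/\ primitive_vec k,
        zeta = (enorm (int_vec R k))^-1 *: int_vec R k \/
        zeta = - ((enorm (int_vec R k))^-1 *: int_vec R k) &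
        h = maxn (absz (k 0 ord0)) (absz (k 0 ord_max))]].

Definition geodesic (R : realType) (p u : 'rV[R]_2) : set (torus R) :=
  [set \pi_(torus R) (p + t *: u) | t in [set: R]].

Definition closed_geodesic (R : realType) (G : set (torus R)) : Prop :=
  exists p u : 'rV[R]_2, rational_direction u /\ G = geodesic p u.

Definition closed_geodesic_orthogonal (R : realType) (zeta : 'rV[R]_2)
  (G : set (torus R)) : Prop :=
  exists p u : 'rV[R]_2,
    [/\ rational_direction u, dot u zeta = 0 & G = geodesic p u].

(* Main.v *)
(* Write -Delta f = E f in Fourier coefficients: the coefficient of f at the
   frequency (m, n) vanishes as soon as 4 pi^2 m^2 > E or 4 pi^2 n^2 > E, since a
   partial coefficient of order m satisfies u'' = (4 pi^2 m^2 - E) u and is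
   periodic.  Hence, with M the integral part of sqrt E / (2 pi),
   z = exp (2 pi i x) and w = exp (2 pi i y), z^M w^M f is a polynomial F of
   bidegree at most (2M, 2M), and the derivative of f along zeta_perp corresponds
   to D F, where D is a combination of z d/dz and w d/dw.

   Let x be a common zero of F and D F that is nonsingular for F.  If F and D F
   share an irreducible factor p vanishing at x, then p is a simple factor of F at
   x, so p divides D p, and D p = c p by comparison of degrees.  The exponents of p
   thus lie on a line orthogonal to zeta_perp: zeta is rational, and p vanishes on
   the closed geodesic through x in the direction zeta_perp.  The other points are
   counted by Bezout's theorem in bidegree (2M, 2M), which gives at most
   8 M^2 <= 2 E / pi^2 of them.  Finally a closed geodesic orthogonal to zeta meets a
   horizontal or vertical circle in h(zeta) points, and f has at most 2M zeros on
   such a circle if it is not identically zero there. *)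

Require Import Defs.
From mathcomp Require Import all_boot all_order all_algebra.
From mathcomp Require Import generic_quotient ring_quotient.
From mathcomp Require Import all_classical all_reals all_analysis.
From mathcomp Require Import measurable_realfun finmap polyXY complex.
From mathcomp Require Import ring lra.

Import Order.TTheory GRing.Theory Num.Theory.
Import numFieldNormedType.Exports.

Local Open Scope classical_set_scope.
Local Open Scope ring_scope.

Set Implicit Arguments.
Unset Strict Implicit.
Unset Printing Implicit Defensive.

(** * Divisibility of bivariate polynomials *)

(** Bidegree matters for the constant: F has total degree up to 4 M, for which the usual Bezout
    bound would be 16 M^2, twice too much. The bound 2 d^2 comes from one resultant in z; several
    points with the same z force a root of that multiplicity, read off from the corank of the
    evaluated Sylvester matrix. F and D F may share a factor h, so Bezout is applied only to the
    cofactors F / h and D F / h, and a nonsingular point on h is handled by the irreducible factor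
    argument. The primality of irreducibles in K[z, w] rests on the same resultants: they lie in the
    ideal generated by the two polynomials, and a factor depending on z alone cancels root by root
    because K is algebraically closed. On the analytic side, the vanishing of the high coefficients
    yields a finite expansion only once a continuous periodic function orthogonal to all harmonics
    is known to be zero. This is obtained by testing against powers of a trigonometric kernel peaked
    at a point. *)

Section BivariatePolynomials.
Variable K : closedFieldType.
Local Notation bipoly := {poly {poly K}}.
Implicit Types (F G p q g h A B : bipoly) (a z w : K).

(** The inner variable is z and the outer one w, so [p.[w%:P].[z]] is the value at (z, w), and
    [eval_inner a] restricts to the line z = a. *)
Definition eval_inner a p : {poly K} := map_poly (horner_eval a) p.

Lemma eval_innerM a p q : eval_inner a (p * q) = eval_inner a p * eval_inner a q.
Proof. exact: rmorphM. Qed.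

Lemma horner_eval_inner a p w : (eval_inner a p).[w] = p.[w%:P].[a].
Proof. by rewrite -[w in LHS](hornerC w a) [LHS](horner_map (horner_eval a)). Qed.

Lemma eval_inner_root a p :
  eval_inner a p = 0 -> exists q, p = ('X - a%:P)%:P * q.
Proof.
move=> p0; exists (map_poly (fun c => c %/ ('X - a%:P)) p).
apply/polyP=> i; rewrite coefCM coef_map_id0 ?div0p // mulrC divpK //.
rewrite dvdp_XsubCl /root; apply/eqP.
by have := congr1 (fun r : {poly K} => r`_i) p0;
  rewrite /= coef0 coef_map_id0 ?horner_evalE ?horner0.
Qed.

Lemma eval_inner_XsubC a p : eval_inner a (('X - a%:P)%:P * p) = 0.
Proof.
by rewrite eval_innerM /eval_inner map_polyC /= horner_evalE hornerXsubC subrr mul0r.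
Qed.

(** The coefficients in z have no common root, which over an algebraically closed field says that
    the content is a unit. *)
Definition primitive2 p := forall a, eval_inner a p != 0.

(* Over an algebraically closed field, Gauss' lemma reduces to cancelling the
   linear factors of the content one root at a time. *)
Lemma primitive2_dvd (r : {poly K}) p A B :
  r != 0 -> primitive2 p -> r%:P * A = p * B -> exists C, A = p * C.
Proof.
move=> + pp; have [n] := ubnP (size r).
elim: n r A B => // n IHn r A B sr r0 e.
have [s1|s1] := leqP (size r) 1.
  have [c rE] : exists c, r = c%:P by exists r`_0; exact: size1_polyC.
  rewrite rE polyC_eq0 in r0 *.
  exists ((c^-1)%:P%:P * B); rewrite mulrCA -e rE mulrA -!polyCM mulVf //.
  by rewrite mul1r.
have /closed_rootP[a] : size r != 1 by rewrite neq_ltn s1 orbT.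
move=> /factor_theorem[r' rE].
have /eqP : eval_inner a (p * B) = 0.
  by rewrite -e rE [r' * _]mulrC polyCM -mulrA eval_inner_XsubC.
rewrite eval_innerM mulf_eq0 (negPf (pp a)) /= => /eqP/eval_inner_root[B' BE].
have r'0 : r' != 0 by apply: contraNneq r0 => r'0; rewrite rE r'0 mul0r.
apply: (IHn r' A B') => //.
  by move: sr; rewrite rE size_mul ?polyXsubC_eq0 // size_XsubC addn2.
apply: (@mulfI _ ('X - a%:P)%:P); first by rewrite polyC_eq0 polyXsubC_eq0.
by rewrite mulrA -polyCM [_ * r']mulrC -rE e BE mulrCA.
Qed.

(** This sum of partial degrees is additive on products and, among nonzero polynomials, vanishes
    exactly on units. It therefore drops when a non-unit factor is removed and serves as a measure
    for induction. *)
Definition deg2 p := ((size p).-1 + (sizeY p).-1)%N.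

Lemma sizeYM p q : p != 0 -> q != 0 -> sizeY (p * q) = (sizeY p + sizeY q).-1.
Proof. by move=> p0 q0; rewrite !sizeYE rmorphM size_mul ?swapXY_eq0. Qed.

Lemma sizeY_gt0 p : p != 0 -> (0 < sizeY p)%N.
Proof. by move=> p0; rewrite lt0n sizeY_eq0. Qed.

Lemma deg2M p q : p != 0 -> q != 0 -> deg2 (p * q) = (deg2 p + deg2 q)%N.
Proof.
move=> p0 q0; rewrite /deg2 size_mul // sizeYM //.
have := sizeY_gt0 p0; have := sizeY_gt0 q0.
have : (0 < size p)%N by rewrite size_poly_gt0.
have : (0 < size q)%N by rewrite size_poly_gt0.
by case: (size p) (size q) (sizeY p) (sizeY q) => [|?] [|?] [|?] [|?] // *;
  rewrite /= !addnS /= addnACA.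
Qed.

Lemma size1_bipoly p : (size p <= 1)%N -> (sizeY p <= 1)%N -> exists c : K, p = c%:P%:P.
Proof.
move=> /size1_polyC pE /=; rewrite pE => s.
exists (p`_0)`_0; congr (_%:P); apply: size1_polyC.
by have := max_size_coefXY p 0; rewrite {2}pE => /leq_trans->.
Qed.

Lemma deg2_unit p : p != 0 -> (p \is a GRing.unit) = (deg2 p == 0).
Proof.
move=> p0; apply/idP/idP => [/unitrP[q [_ pq]]|].
  have q0 : q != 0 by apply: contra_eq_neq pq => ->; rewrite mulr0 eq_sym oner_eq0.
  have := deg2M p0 q0; rewrite pq /deg2 size_poly1 sizeYE rmorph1 size_poly1.
  by move/esym/eqP; rewrite addn_eq0 => /andP[].
rewrite /deg2 addn_eq0 => /andP[s1 s2].
have [||c pE] := @size1_bipoly p.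
- by move: s1; case: (size p) => [|[]].
- by move: s2; case: (sizeY p) => [|[]].
rewrite pE poly_unitE size_polyC polyC_eq0.
move: p0; rewrite pE !polyC_eq0 => c0; rewrite c0 coefC eqxx poly_unitE size_polyC c0
  coefC eqxx.
by rewrite unitfE.
Qed.

Definition irreducible2 p :=
  [/\ p != 0, p \isn't a GRing.unit &
    forall A B, p = A * B -> A \is a GRing.unit \/ B \is a GRing.unit].

(** Stated through common divisors because coprime elements of K[z, w], such as z and w, may
    generate a proper ideal. *)
Definition coprime2 p q := forall g A B,
  p = g * A -> q = g * B -> g \is a GRing.unit.

(** In a product of two non-units one factor still vanishes at the point, and its [deg2] is
    smaller. *)
Lemma irreducible2_factor p w z : p != 0 -> p.[w%:P].[z] = 0 ->
  exists q r, [/\ irreducible2 q, p = q * r & q.[w%:P].[z] = 0].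
Proof.
have [n] := ubnP (deg2 p).
elim: n p => // n IHn p sp p0 pz.
have pNu : p \isn't a GRing.unit.
  apply/negP=> /unitrP[q [_ pq]].
  have := congr1 (fun r : bipoly => r.[w%:P].[z]) pq.
  by rewrite /= !hornerE pz mul0r => /eqP; rewrite eq_sym oner_eq0.
have [irr|/existsNP[A /existsNP[B]]] := pselect (forall A B, p = A * B ->
    A \is a GRing.unit \/ B \is a GRing.unit).
  by exists p, 1; split; rewrite ?mulr1.
move=> /not_implyP[pE /not_orP[Au Bu]].
have A0 : A != 0 by apply: contraNneq p0 => A0; rewrite pE A0 mul0r.
have B0 : B != 0 by apply: contraNneq p0 => B0; rewrite pE B0 mulr0.
have Ad : (0 < deg2 A)%N by rewrite lt0n -deg2_unit //; exact/negP.
have Bd : (0 < deg2 B)%N by rewrite lt0n -deg2_unit //; exact/negP.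
rewrite pE deg2M // in sp.
move: pz; rewrite pE !hornerM => /eqP; rewrite mulf_eq0 => /orP[] /eqP z0.
  have sA : (deg2 A < n)%N by rewrite -ltnS (leq_trans _ sp) // ltnS -addn1 leq_add2l.
  have [q [r [qi qr qz]]] := IHn A sA A0 z0.
  by exists q, (r * B); split => //; rewrite qr mulrA.
have sB : (deg2 B < n)%N by rewrite -ltnS (leq_trans _ sp) // ltnS -add1n leq_add2r.
have [q [r [qi qr qz]]] := IHn B sB B0 z0.
by exists q, (A * r); split => //; rewrite qr mulrCA.
Qed.

(** Common non-unit divisors are split off until none is left, and [deg2 p] drops each time. The
    polynomial [q] may be zero: it will be D F, which can vanish identically. *)
Lemma gcd2_exists p q : p != 0 ->
  exists h A B, [/\ p = h * A, q = h * B & coprime2 A B].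
Proof.
have [n] := ubnP (deg2 p); elim: n p q => // n IHn p q sp p0.
have [c|/existsNP[g /existsNP[A /existsNP[B]]]] := pselect (coprime2 p q).
  by exists 1, p, q; rewrite !mul1r.
move=> /not_implyP[pE /not_implyP[qE /negP gu]].
have g0 : g != 0 by apply: contraNneq p0 => g0; rewrite pE g0 mul0r.
have A0 : A != 0 by apply: contraNneq p0 => A0; rewrite pE A0 mulr0.
have sA : (deg2 A < n)%N.
  move: sp gu; rewrite pE deg2M // deg2_unit // -lt0n => sp gu.
  by rewrite -ltnS (leq_trans _ sp) // ltnS -add1n leq_add2r.
have [h [A' [B' [AE BE c]]]] := IHn A B sA A0.
by exists (g * h), A', B'; rewrite -!mulrA -AE -BE.
Qed.

Lemma primitive2_part p : p != 0 ->
  exists (c : {poly K}) g, [/\ c != 0, primitive2 g & p = c%:P * g].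
Proof.
have [n] := ubnP (sizeY p); elim: n p => // n IHn p sp p0.
have [c|/existsNP[a /negP]] := pselect (primitive2 p).
  by exists 1, p; rewrite oner_eq0 mul1r.
rewrite negbK => /eqP/eval_inner_root[q pE].
have q0 : q != 0 by apply: contraNneq p0 => q0; rewrite pE q0 mulr0.
have X0 : ('X - a%:P)%:P != 0 :> bipoly by rewrite polyC_eq0 polyXsubC_eq0.
have sq : (sizeY q < n)%N.
  move: sp; rewrite pE sizeYM // (sizeYE _%:P) swapXY_polyC size_map_polyC.
  by rewrite size_XsubC add2n.
have [c [g [c0 gp qE]]] := IHn q sq q0.
exists (('X - a%:P) * c), g; split => //.
  by rewrite mulf_neq0 // polyXsubC_eq0.
by rewrite pE qE mulrA polyCM.
Qed.

(** A vanishing resultant gives a gcd of positive degree in w over the fraction field K(z). Its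
    primitive part keeps this degree, so it is not a unit, and it divides both polynomials over K[z]
    by [primitive2_dvd]. *)
Lemma resultant0_common p q : resultant p q = 0 -> ~ coprime2 p q.
Proof.
move=> /eqP; rewrite resultant_eq0 => sg cpq.
have g0 : gcdp p q != 0 by rewrite -size_poly_gt0 ltnW.
have [c [g [c0 gp gE]]] := primitive2_part g0.
have gn0 : g != 0 by apply: contraNneq g0 => gn0; rewrite gE gn0 mulr0.
have common u : gcdp p q %| u -> exists C, u = g * C.
  move=> /Pdiv.Idomain.dvdpP[[k r] /= k0 kr].
  by apply: (@primitive2_dvd k g u (c%:P * r)) => //;
    rewrite mul_polyC kr gE mulrA mulrC [r * _]mulrC.
have [A pE] := common _ (dvdp_gcdl p q); have [B qE] := common _ (dvdp_gcdr p q).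
have := cpq g A B pE qE; rewrite deg2_unit // addn_eq0 => /andP[s _].
move: sg; rewrite gE mul_polyC size_scale //.
by move: s; case: (size g) => [|[]].
Qed.

(** For a primitive p with nonzero resultant r = u p + v q one has r A = p (u A + v B), and r, a
    polynomial in z alone, cancels by Gauss' lemma. If the resultant vanishes, the common factor is
    p up to a unit, so p divides q. *)
Lemma irreducible2_prime p A q B : irreducible2 p -> A * q = p * B ->
  (exists C, A = p * C) \/ (exists C, q = p * C).
Proof.
move=> [p0 pu pirr] e.
have [pp|/existsNP[a /negP]] := pselect (primitive2 p); last first.
  (* A non-primitive irreducible p is z - a up to a unit; evaluation at z = a, with values in the
     domain K[w], shows which factor it divides. *)
  rewrite negbK => /eqP/eval_inner_root[s pE].
  have su : s \is a GRing.unit.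
    have [|//] := pirr _ _ pE.
    rewrite (poly_unitE ('X - a%:P)%:P) coefC eqxx (poly_unitE ('X - a%:P)).
    by rewrite size_XsubC andbF.
  have dv C : eval_inner a C = 0 -> exists D, C = p * D.
    move=> /eval_inner_root[D ->]; exists (s^-1 * D).
    by rewrite pE -mulrA [s * _]mulrA divrr // mul1r.
  have := congr1 (eval_inner a) e; rewrite pE -mulrA eval_inner_XsubC eval_innerM -pE.
  by move=> /eqP; rewrite mulf_eq0 => /orP[] /eqP /dv dvd; [left|right].
have [r0|r0] := eqVneq (resultant p q) 0.
  right; have /existsNP[g /existsNP[C /existsNP[D]]] := resultant0_common r0.
  move=> /not_implyP[pE /not_implyP[qE gu]].
  have [//|Cu] := pirr _ _ pE.
  by exists (C^-1 * D); rewrite pE mulrA mulrK.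
(* A primitive polynomial free of w has no root in z, so it would be a constant, hence a unit. *)
have sp : (1 < size p)%N.
  rewrite ltnNge; apply/negP=> /size1_polyC pE; move: (pu).
  rewrite deg2_unit // pE /deg2 sizeYE swapXY_polyC size_map_polyC.
  have c0 : p`_0 != 0 by move: p0; rewrite {1}pE polyC_eq0.
  rewrite size_polyC c0 /= add0n => sp.
  have /closed_rootP[a ra] : size p`_0 != 1.
    by apply: contraNneq sp => ->.
  by have := pp a; rewrite pE /eval_inner map_polyC /= horner_evalE (rootP ra) polyC0
    eqxx.
(* If [q] is free of w, it takes the place of the resultant. *)
left; have [sq|sq] := leqP (size q) 1.
  have qE := size1_polyC sq.
  have q0 : q`_0 != 0.
    apply: contraNneq r0 => q00; rewrite resultant_eq0 qE q00 polyC0 gcdp0 //.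
  by apply: (@primitive2_dvd q`_0 p A B) => //; rewrite -qE mulrC.
have [uv _ rE] := resultant_in_ideal sp sq.
apply: (@primitive2_dvd (resultant p q) p A (uv.1 * A + uv.2 * B)) => //.
rewrite rE mulrDl mulrDr -!mulrA [q * A]mulrC e; congr (_ + _).
  by rewrite mulrCA [uv.1 * _]mulrC mulrA.
by rewrite mulrCA.
Qed.

End BivariatePolynomials.

(** * Bezout's theorem by the resultant *)

Lemma size_det (K : fieldType) n d (M : 'M[{poly K}]_n) :
  (forall i j, (size (M i j) <= d.+1)%N) -> (size (\det M) <= (n * d).+1)%N.
Proof.
move=> sM; apply: leq_trans (size_sum _ _ _) _; apply/bigmax_leqP => s _.
have -> : (-1) ^+ perm.odd_perm s = ((-1) ^+ perm.odd_perm s : K)%:P.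
  by rewrite rmorphXn rmorphN rmorph1.
rewrite mul_polyC; apply: leq_trans (size_scale_leq _ _) _.
apply: leq_trans (size_prod_leq _ _) _; rewrite leq_subLR card_ord.
rewrite addnS ltnS -[X in (_ <= X + _)%N]muln1 -mulnDr add1n.
rewrite -[X in (_ <= X * _)%N]card_ord -sum_nat_const.
by apply: leq_sum => i _.
Qed.

(** * Order of vanishing of a determinant and corank *)

Section Corank.
Variable K : fieldType.

(** An invertible scalar column operation turns the k kernel vectors of M(a) into the first k
    columns, whose entries then all vanish at a; each of these columns contributes a factor X - a to
    the determinant. *)
Lemma dvdp_det_corank n k (M : 'M[{poly K}]_n) (a : K) (V : 'M[K]_(n, k)) :
  map_mx (horner_eval a) M *m V = 0 -> \rank V = k ->
  ('X - a%:P) ^+ k %| \det M.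
Proof.
move=> MV rV.
have kn : (k <= n)%N by rewrite -rV rank_leq_row.
pose Q := col_ebase V; pose N := M *m map_mx polyC Q.
have evN : map_mx (horner_eval a) N = map_mx (horner_eval a) M *m Q.
  rewrite map_mxM -map_mx_comp; congr (_ *m _).
  by apply/matrixP => i j; rewrite !mxE /= horner_evalE hornerC.
have MQ0 : map_mx (horner_eval a) M *m Q *m pid_mx k = 0 :> 'M[K]_(n, k).
  have := mulmx_ebase V; rewrite rV => VE.
  have QE := canRL (mulmxK (row_ebase_unit V)) VE.
  by rewrite -mulmxA [X in _ *m X]QE mulmxA MV mul0mx.
have N0 i (j : 'I_n) : (j < k)%N -> ('X - a%:P) %| N i j.
  move=> jk; rewrite dvdp_XsubCl /root; apply/eqP.
  have := congr1 (fun A : 'M[K]_(n, k) => A i (Ordinal jk)) MQ0.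
  rewrite !mxE (bigD1 j) //= big1 ?addr0 => [|l lj]; last first.
    by move: lj; rewrite -val_eqE [pid_mx _ _ _]mxE /= => /negPf ->; rewrite mulr0.
  by rewrite -evN !mxE /= eqxx jk mulr1 horner_evalE.
pose D := \row_(j < n) (if (j < k)%N then 'X - a%:P else 1 : {poly K}).
have DE j : D 0 j = if (j < k)%N then 'X - a%:P else 1 by rewrite mxE.
have NE : N = (\matrix_(i, j) (N i j %/ D 0 j)) *m diag_mx D.
  apply/matrixP => i j; rewrite mul_mx_diag [RHS]mxE [X in X * _]mxE.
  rewrite DE; case: ifP => [jk|_]; last by rewrite divp1 mulr1.
  by rewrite divpK // N0.
have : ('X - a%:P) ^+ k %| \det N.
  rewrite NE det_mulmx dvdp_mull // det_diag.
  rewrite (eq_bigr (fun j : 'I_n => if (j < k)%N then 'X - a%:P else 1)); last first.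
    by move=> j _; rewrite DE.
  rewrite -big_mkcond /= prodr_const -[X in _ ^+ X %| _](card_ord k).
  have -> : #|[pred i : 'I_n | (i < k)%N]| = k; last by rewrite card_ord.
  rewrite -[RHS](card_ord k) -[RHS](card_codom (f := widen_ord kn)).
    apply: eq_card => i; rewrite !inE; apply/idP/codomP => [ik|[j ->]].
      by exists (Ordinal ik); apply: val_inj.
    exact: (valP j).
  by move=> i j /(congr1 val) /= ij; apply: val_inj.
rewrite det_mulmx det_map_mx mulrC mul_polyC dvdpZr //.
by rewrite -unitfE -unitmxE col_ebase_unit.
Qed.

Lemma rank_vandermonde n k (w : 'I_k -> K) : injective w -> (k <= n)%N ->
  \rank (\matrix_(i < n, j < k) w j ^+ i) = k.
Proof.
move=> wI kn; apply/eqP; rewrite eqn_leq rank_leq_col /=.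
set V := (X in \rank X).
apply: (@leq_trans (\rank (rowsub (widen_ord kn) V))); last first.
  exact/mxrankS/rowsub_sub.
have -> : rowsub (widen_ord kn) V =
    Vandermonde k (\row_j w j).
  by apply/matrixP => i j; rewrite !mxE.
rewrite mxrank_unit // unitmxE unitfE det_Vandermonde.
apply/prodf_neq0 => i _; apply/prodf_neq0 => j ij.
rewrite !mxE subr_eq0; apply: contraTneq ij => /wI ->.
by rewrite ltnn.
Qed.

End Corank.

Section Bezout.
Variable K : closedFieldType.
Local Notation bipoly := {poly {poly K}}.
Implicit Types (F G : bipoly) (a w : K).

(** The rows of the Sylvester matrix hold the coefficients of the shifts w^l F and w^l G, so its
    product with the powers of a common root evaluates these shifts there. The sizes are those
    before evaluation: leading coefficients may vanish at a. *)
Lemma Sylvester_eval_vandermonde F G a k (w : 'I_k -> K) :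
  (forall j, (eval_inner a F).[w j] = 0) ->
  (forall j, (eval_inner a G).[w j] = 0) ->
  map_mx (horner_eval a) (Sylvester_mx F G) *m (\matrix_(i, j) w j ^+ i) = 0.
Proof.
move=> Fw Gw; apply/matrixP => i j; rewrite !mxE.
have key H l : (eval_inner a H).[w j] = 0 ->
    ((size H).-1 + l < (size G).-1 + (size F).-1)%N ->
    \sum_(k0 < (size G).-1 + (size F).-1)
      (H`_(k0 - l) *+ (l <= k0)%N).[a] * w j ^+ k0 = 0.
  move=> Hw lt; transitivity (w j ^+ l * (eval_inner a H).[w j]);
    last by rewrite Hw mulr0.
  set n := ((size G).-1 + (size F).-1)%N in lt *.
  have sH : (size ('X^l * eval_inner a H)%R <= n)%N.
    have [H0|H0] := eqVneq H 0.
      by rewrite /eval_inner H0 map_poly0 mulr0 size_poly0.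
    have sH : (0 < size H)%N by rewrite size_poly_gt0.
    apply: leq_trans (size_polyMleq _ _) _; rewrite size_polyXn addSn /=.
    apply: leq_trans lt; rewrite -addSn (prednK sH) addnC leq_add2r.
    exact: size_poly.
  rewrite -[w j ^+ l]hornerXn -hornerM (horner_coef_wide _ sH).
  apply: eq_bigr => i0 _; congr (_ * _); rewrite coefXnM.
  case: ltnP => _; first by rewrite mulr0n horner0.
  by rewrite mulr1n coef_map_id0 ?horner_evalE ?horner0.
under eq_bigr do rewrite [X in X * _]mxE [X in _ * X]mxE horner_evalE Sylvester_mxE.
case: splitP => l _ /=; apply: key => //.
  by rewrite addnC ltn_add2r.
by rewrite ltn_add2l.
Qed.

(** Distinct common zeros on the line z = a give independent Vandermonde vectors in the kernel of
    the Sylvester matrix at a, hence a root of that multiplicity of the resultant. *)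
Lemma bezout_fiber F G a (s : seq K) : coprime2 F G -> uniq s ->
  (forall w, w \in s -> (eval_inner a F).[w] = 0 /\ (eval_inner a G).[w] = 0) ->
  ('X - a%:P) ^+ size s %| resultant F G.
Proof.
move=> cFG us sFG.
(* Independence requires at least as many rows as points. By coprimality F and G do not both vanish
   on z = a, and a nonzero restriction has at most as many roots as its degree. *)
have sz : (size s <= (size G).-1 + (size F).-1)%N.
  have bound H : (forall w, w \in s -> (eval_inner a H).[w] = 0) ->
      eval_inner a H != 0 -> (size s <= (size H).-1)%N.
    move=> Hs H0; have : (size s < size (eval_inner a H))%N.
      by apply: max_poly_roots => //; apply/allP => w /Hs /eqP.
    move=> /leq_trans/(_ (size_poly _ _)).
    by case: (size H).
  have [F0|F0] := eqVneq (eval_inner a F) 0; last first.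
    by apply: leq_trans (bound F _ F0) (leq_addl _ _) => w /sFG[].
  have [G0|G0] := eqVneq (eval_inner a G) 0; last first.
    by apply: leq_trans (bound G _ G0) (leq_addr _ _) => w /sFG[].
  have [[A FE] [B GE]] := (eval_inner_root F0, eval_inner_root G0).
  have := cFG _ _ _ FE GE.
  by rewrite poly_unitE coefC eqxx (poly_unitE ('X - a%:P)) size_XsubC andbF.
pose w (j : 'I_(size s)) := s`_j.
apply: (dvdp_det_corank (V := \matrix_(i, j) w j ^+ i)).
  by apply: Sylvester_eval_vandermonde => j;
    have [] := sFG (w j) (mem_nth 0 (ltn_ord j)).
apply: rank_vandermonde => // i j /eqP; rewrite nth_uniq // => /eqP.
exact: val_inj.
Qed.

Lemma size_prod_XsubC_exp (I : Type) (r : seq I) (x : I -> K) (n : I -> nat) :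
  size (\prod_(i <- r) ('X - (x i)%:P) ^+ n i) = (\sum_(i <- r) n i).+1.
Proof.
have mon i : ('X - (x i)%:P) ^+ n i \is monic by rewrite monic_exp ?monicXsubC.
elim: r => [|i r IHr]; first by rewrite !big_nil size_poly1.
rewrite !big_cons size_Mmonic ?monic_neq0 //; last by rewrite monic_prod.
by rewrite IHr size_exp_XsubC addSn /= addnS.
Qed.

Lemma dvdp_prod_XsubC_exp (r : seq K) (n : K -> nat) (p : {poly K}) : uniq r ->
  (forall x, x \in r -> ('X - x%:P) ^+ n x %| p) ->
  \prod_(x <- r) ('X - x%:P) ^+ n x %| p.
Proof.
elim: r => [|x r IHr] /=; first by rewrite big_nil dvd1p.
move=> /andP[xr ur] rp; rewrite big_cons Gauss_dvdp.
  by rewrite rp ?mem_head // IHr // => y yr; rewrite rp // inE yr orbT.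
rewrite big_seq; apply: (big_ind (coprimep _)); first exact: coprimep1.
  by move=> q q' cq cq'; rewrite coprimepMr cq.
move=> y yr; apply/coprimep_expl/coprimep_expr.
rewrite coprimep_XsubC root_XsubC.
by apply: contraNneq xr => <-.
Qed.

(* The bound is the intersection number of two curves of bidegree (d, d) on
   P^1 x P^1; points are written (outer variable, inner variable). *)
Lemma bezout F G d (s : seq (K * K)) : coprime2 F G ->
  (size F <= d.+1)%N -> (size G <= d.+1)%N ->
  (sizeY F <= d.+1)%N -> (sizeY G <= d.+1)%N -> uniq s ->
  (forall x, x \in s -> F.[x.1%:P].[x.2] = 0 /\ G.[x.1%:P].[x.2] = 0) ->
  (size s <= 2 * d ^ 2)%N.
Proof.
move=> cFG sF sG sYF sYG us sFG.
have R0 : resultant F G != 0.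
  by apply/negP => /eqP /resultant0_common; apply.
(* Entries have degree at most d in z and the matrix has at most 2 d rows, whence 2 d^2. *)
have sR : (size (resultant F G) <= (((size G).-1 + (size F).-1) * d).+1)%N.
  apply: size_det => i j; rewrite Sylvester_mxE.
  have sc H k m : (sizeY H <= d.+1)%N -> (size (H`_k *+ m) <= d.+1)%N.
    by move=> sH; rewrite -scaler_nat (leq_trans (size_scale_leq _ _)) // (leq_trans
      (max_size_coefXY _ _)).
  by case: splitP => k _; apply: sc.
pose fiber z := [seq x.1 | x <- s & x.2 == z].
pose zs := undup [seq x.2 | x <- s].
have dv : \prod_(z <- zs) ('X - z%:P) ^+ size (fiber z) %| resultant F G.
  apply: dvdp_prod_XsubC_exp; first exact: undup_uniq.
  move=> z _; apply: bezout_fiber => // [|w].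
    rewrite map_inj_in_uniq ?filter_uniq // => x y.
    rewrite !mem_filter => /andP[/eqP xz _] /andP[/eqP yz _] xy.
    by rewrite [x]surjective_pairing [y]surjective_pairing xz yz xy.
  move=> /mapP[x]; rewrite mem_filter => /andP[/eqP <- xs] ->.
  by rewrite !horner_eval_inner; apply: sFG.
have sE : size s = (\sum_(z <- zs) size (fiber z))%N.
  rewrite -(size_map (fun x : K * K => x.2)) -sum1_size -(big_undup_iterop_count).
  rewrite /zs; apply: eq_bigr => z _; rewrite Monoid.iteropE iter_addn_0 mul1n.
  by rewrite size_map size_filter count_map.
have := dvdp_leq R0 dv; rewrite size_prod_XsubC_exp -sE => /leq_trans/(_ sR).
rewrite ltnS => /leq_trans; apply; rewrite expnS expn1 mulnA leq_mul2r mul2n -addnn.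
rewrite leq_add ?orbT //.
  by case: (size G) sG.
by case: (size F) sF.
Qed.

End Bezout.

(** * Directional derivations *)

Section DirectionalDerivation.
Variable K : closedFieldType.
Local Notation bipoly := {poly {poly K}}.
Implicit Types (F G p q : bipoly) (a w z al be : K).

Definition deriv_inner p : bipoly := swapXY (swapXY p)^`().

Lemma deriv_innerM p q :
  deriv_inner (p * q) = deriv_inner p * q + p * deriv_inner q.
Proof.
by rewrite /deriv_inner rmorphM derivM rmorphD !rmorphM /= !swapXYK.
Qed.

(* With z, w the inner and outer variables this is al z d/dz + be w d/dw, i.e.
   differentiation in the direction (al, be) in the angular coordinates. *)
Definition dirD al be p : bipoly :=
  al%:P%:P * 'Y * deriv_inner p + be%:P%:P * 'X * p^`().

Lemma dirDM al be p q : dirD al be (p * q) = dirD al be p * q + p * dirD al be q.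
Proof. by rewrite /dirD deriv_innerM derivM; ring. Qed.

(** The monomial z^i w^j is an eigenvector of the derivation, with eigenvalue al i + be j. *)
Lemma coef_dirD al be p j i :
  (dirD al be p)`_j`_i = (al * i%:R + be * j%:R) * p`_j`_i.
Proof.
rewrite /dirD coefD coefD -!mulrA !coefCM mulrDl -!mulrA; congr (_ * _ + _ * _).
  rewrite coefXM /deriv_inner; case: i => [|i] /=; first by rewrite mul0r.
  by rewrite coef_swapXY coef_deriv coefMn coef_swapXY mulr_natl.
rewrite coefXM; case: j => [|j] /=; first by rewrite ?coef0 ?nth_nil ?mul0r ?mulr0.
by rewrite coef_deriv coefMn mulr_natl.
Qed.

Lemma size_dirD al be p : (size (dirD al be p) <= size p)%N.
Proof.
apply/leq_sizeP => j pj; apply/polyP => i.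
by rewrite coef_dirD (nth_default 0 pj) coef0 mulr0.
Qed.

Lemma sizeY_dirD al be p : (sizeY (dirD al be p) <= sizeY p)%N.
Proof.
rewrite !sizeYE; apply/leq_sizeP => i pi; apply/polyP => j.
by rewrite coef_swapXY coef_dirD -(coef_swapXY p) (nth_default 0 pi) !coef0 mulr0.
Qed.

Lemma size_factor p q : q != 0 -> (size p <= size (p * q)%R)%N.
Proof.
move=> q0; have [->|p0] := eqVneq p 0; first by rewrite size_poly0.
by rewrite size_mul // -subn1 -addnBA ?size_poly_gt0 // leq_addr.
Qed.

Lemma sizeY_factor p q : q != 0 -> (sizeY p <= sizeY (p * q)%R)%N.
Proof.
move=> q0; have [->|p0] := eqVneq p 0; first by rewrite sizeYE rmorph0 size_poly0.
by rewrite sizeYM // -subn1 -addnBA ?sizeY_gt0 // leq_addr.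
Qed.

(** The derivation raises neither partial degree, so the quotient C is a constant, and every
    monomial of p has this constant as eigenvalue. *)
Lemma dirD_eigen al be p C : p != 0 -> dirD al be p = p * C ->
  exists c, forall j i, p`_j`_i != 0 -> al * i%:R + be * j%:R = c.
Proof.
move=> p0 e.
have [c CE] : exists c : K, C = c%:P%:P.
  have [->|C0] := eqVneq C 0; first by exists 0; rewrite !polyC0.
  apply: size1_bipoly.
    have := size_dirD al be p; rewrite e size_mul //.
    have : (0 < size p)%N by rewrite size_poly_gt0.
    by case: (size p) => // n _; rewrite addSn /= -addn1 addnC -addn1 addnC leq_add2l.
  have := sizeY_dirD al be p; rewrite e sizeYM //.
  have : (0 < sizeY p)%N by rewrite sizeY_gt0.
  by case: (sizeY p) => // n _; rewrite addSn /= -addn1 leq_add2l.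
exists c => j i pji; apply: (mulIf pji).
by rewrite -coef_dirD e CE mulrC !coefCM.
Qed.

(* A common zero x of F and dirD F that is nonsingular for F and lies on a
   common component p forces p to divide dirD p, i.e. p to be an eigenvector of
   the derivation; the remaining points are counted by Bezout. *)
Lemma card_dirD_zeros al be F d (s : seq (K * K)) : F != 0 ->
  (size F <= d.+1)%N -> (sizeY F <= d.+1)%N -> uniq s ->
  (forall x, x \in s ->
    [/\ F.[x.1%:P].[x.2] = 0, (dirD al be F).[x.1%:P].[x.2] = 0,
        (deriv_inner F).[x.1%:P].[x.2] != 0 \/ F^`().[x.1%:P].[x.2] != 0 &
        ~ exists p q c, [/\ F = p * q, p.[x.1%:P].[x.2] = 0 &
          forall j i, p`_j`_i != 0 -> al * i%:R + be * j%:R = c]]) ->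
  (size s <= 2 * d ^ 2)%N.
Proof.
move=> F0 sF sYF us sP.
have [h [A [B [FE DE cAB]]]] := gcd2_exists (dirD al be F) F0.
have h0 : h != 0 by apply: contraNneq F0 => h0; rewrite FE h0 mul0r.
have hB : (size B <= d.+1)%N.
  apply: leq_trans (size_factor B h0) _; rewrite mulrC -DE.
  exact: leq_trans (size_dirD _ _ _) sF.
have hYB : (sizeY B <= d.+1)%N.
  apply: leq_trans (sizeY_factor B h0) _; rewrite mulrC -DE.
  exact: leq_trans (sizeY_dirD _ _ _) sYF.
have hA : (size A <= d.+1)%N.
  by apply: leq_trans (size_factor A h0) _; rewrite mulrC -FE.
have hYA : (sizeY A <= d.+1)%N.
  by apply: leq_trans (sizeY_factor A h0) _; rewrite mulrC -FE.
apply: (bezout cAB) => // x xs; have [Fx Dx nsing noeig] := sP x xs.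
have hx : h.[x.1%:P].[x.2] != 0.
  apply/eqP => hx.
  have [p [r [pirr hE px]]] := irreducible2_factor h0 hx.
  have FE' : F = p * (r * A) by rewrite mulrA -hE.
  (* Product rule for F = p (r A), combined with D F = h B = p r B. *)
  have e : dirD al be p * (r * A) = p * (r * B - dirD al be (r * A)).
    apply/eqP; rewrite mulrBr -subr_eq opprK -dirDM -FE' DE hE mulrA.
    exact/eqP.
  have [[C DpC]|[C qC]] := irreducible2_prime pirr e.
    have [p0 _ _] := pirr; have [c pc] := dirD_eigen p0 DpC.
    by apply: noeig; exists p, (r * A), c.
  (* If p divides r A, then p^2 divides F and both partial derivatives of F vanish at the point. *)
  case: nsing; rewrite FE' qC ?deriv_innerM ?derivM !(hornerD, hornerM) px.
    by rewrite !(mul0r, mulr0, addr0) eqxx.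
  by rewrite !(mul0r, mulr0, addr0) eqxx.
move: Fx Dx; rewrite DE FE !hornerM => /eqP; rewrite mulf_eq0 (negPf hx) /= => /eqP Ax.
by move=> /eqP; rewrite mulf_eq0 (negPf hx) /= => /eqP Bx.
Qed.

End DirectionalDerivation.

(** * Fourier series on the unit interval *)

Section UnitIntervalIntegral.
Variable R : realType.
Implicit Types (f g : R -> R).
Local Notation mu := lebesgue_measure.

Definition int01 g : R := \int[mu]_(x in `[0, 1]) g x.

Lemma measurable_01 : measurable (`[0, 1]%classic : set (measurableTypeR R)).
Proof. exact: measurable_itv. Qed.

Lemma integrable01 g : continuous g -> mu.-integrable `[0, 1] (EFin \o g).
Proof.
move=> cg; apply: continuous_compact_integrable; first exact: segment_compact.
exact: continuous_subspaceT.
Qed.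

Lemma int01D f g : continuous f -> continuous g ->
  int01 (fun x => f x + g x) = int01 f + int01 g.
Proof. by move=> cf cg; rewrite /int01 RintegralD //; exact: integrable01. Qed.

Lemma int01Z f (c : R) : continuous f ->
  int01 (fun x => c * f x) = c * int01 f.
Proof. by move=> cf; rewrite /int01 RintegralZl //; exact: integrable01. Qed.

Lemma int01_cst (c : R) : int01 (fun=> c) = c.
Proof.
rewrite /int01 Rintegral_cst //. rewrite /= lebesgue_measure_itv /= lte_fin ltr01.
by rewrite oppr0 adde0 /= mulr1.
Qed.

Lemma int01_sum (I : Type) (r : seq I) (F : I -> R -> R) :
  (forall i, continuous (F i)) ->
  int01 (fun x => \sum_(i <- r) F i x) = \sum_(i <- r) int01 (F i).
Proof.
move=> cF; elim: r => [|i r IHr].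
  by rewrite big_nil -[RHS](int01_cst 0); congr int01; apply/funext => x;
    rewrite big_nil.
rewrite big_cons -IHr -int01D //.
  by congr int01; apply/funext => x; rewrite big_cons.
elim: r {IHr} => [|j r IHr].
  have -> : (fun x => \sum_(j <- [::]) F j x) = cst 0.
    by apply/funext => x; rewrite big_nil.
  exact: cst_continuous.
have -> : (fun x => \sum_(i <- j :: r) F i x) = (fun x => F j x + \sum_(i <- r) F i x).
  by apply/funext => x; rewrite big_cons.
by move=> x; apply: cvgD; [exact: cF|exact: IHr].
Qed.

Lemma le_int01 f g : continuous f -> continuous g ->
  (forall x, x \in `[0, 1] -> f x <= g x) -> int01 f <= int01 g.
Proof.
by move=> cf cg fg; apply: le_Rintegral => //; exact: integrable01.
Qed.

Lemma int01_FTC (F f : R -> R) : continuous f ->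
  (forall x : R, is_derive x 1 F (f x)) -> int01 f = F 1 - F 0.
Proof.
move=> cf dF.
have cF x : {for x, continuous F}.
  apply: differentiable_continuous; apply/derivable1_diffP.
  by have [] := dF x.
rewrite /int01 /Rintegral (@continuous_FTC2 R f F 0 1) //.
- exact: continuous_subspaceT.
- split=> [x _||].
  + by have [] := dF x.
  + by apply: cvg_at_right_filter; exact: cF.
  + by apply: cvg_at_left_filter; exact: cF.
- by move=> x _; rewrite derive1E; apply: derive_val.
Qed.

Lemma int01_gt0 g (x0 : R) : continuous g ->
  (forall x, x \in `[0, 1] -> 0 <= g x) -> x0 \in `]0, 1[ -> 0 < g x0 ->
  0 < int01 g.
Proof.
move=> cg g0 x01 gx0.
have : \forall x \near x0, g x0 / 2 < g x /\ x \in `]0, 1[.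
  near=> x; split.
    near: x; apply: (cvgr_gt (g x0)); [exact: cg|lra].
  by near: x; exact: near_in_itvoo.
case=> d /= d0 Hd.
pose a := x0 - d / 2; pose b := x0 + d / 2.
have ab x : x \in `[a, b] -> g x0 / 2 < g x /\ x \in `]0, 1[.
  rewrite in_itv /= => /andP[ax xb]; apply: Hd => /=.
  by rewrite distrC ltr_norml; apply/andP; split; rewrite /a /b in ax xb; lra.
have fin : (int01 g)%:E = (\int[mu]_(x in `[0%R, 1%R]) (g x)%:E)%E.
  rewrite /int01 /Rintegral fineK //; apply: integrable_fin_num => //.
  exact: integrable01.
rewrite -lte_fin fin; apply: (@lt_le_trans _ _ (\int[mu]_(x in `[a, b]) (g x)%:E)%E).
  apply: (@lt_le_trans _ _ (\int[mu]_(x in `[a, b]) (g x0 / 2)%:E)%E); last first.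
    apply: ge0_le_integral => //.
    - by move=> x _; rewrite lee_fin; lra.
    - apply/measurable_EFinP; apply: measurable_funTS.
      exact: continuous_measurable_fun.
    - by move=> x /ab[gx _]; rewrite lee_fin ltW.
  rewrite integral_cst //= lebesgue_measure_itv /= lte_fin ifT;
    last by rewrite /a /b; lra.
  by rewrite -EFinB -EFinM lte_fin mulr_gt0 // /a /b; lra.
apply: ge0_subset_integral => //.
- apply/measurable_EFinP; apply: measurable_funTS.
  exact: continuous_measurable_fun.
- by move=> x /ab[_ x01']; apply: subset_itv_oo_cc.
Unshelve. all: by end_near. Qed.

Lemma int01_is_derive (f df : R -> R -> R) (a : R) :
  (forall t x : R, is_derive t 1 (f ^~ x) (df t x)) ->
  (forall t, continuous (f t)) ->
  (exists C, forall t x, `|df t x| <= C) ->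
  is_derive a 1 (fun t => int01 (f t)) (int01 (df a)).
Proof.
move=> dfP cf [C Cdf].
have d1 t x : partial1of2 f t x = df t x.
  by rewrite partial1of2E; apply: derive_val.
have C0 : 0 <= C by exact: le_trans (normr_ge0 _) (Cdf 0 0).
have Ia : (`]a - 1, a + 1[%classic : set R) a.
  by rewrite /= in_itv /=; apply/andP; split; lra.
have intf x : (`]a - 1, a + 1[%classic : set R) x -> mu.-integrable `[0,
  1] (EFin \o f x).
  by move=> _; exact: integrable01.
have derf x y : (`]a - 1, a + 1[%classic : set R) x -> (`[0, 1]%classic :
  set R) y -> derivable (f ^~ y) x 1.
  by move=> _ _; have [] := dfP x y.
have intC : mu.-integrable `[0, 1] (EFin \o (fun=> C)).
  by apply: integrable01; exact: cst_continuous.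
have ub x y : (`]a - 1, a + 1[%classic : set R) x -> (`[0, 1]%classic : set R) y ->
    `|partial1of2 f x y| <= C by move=> _ _; rewrite d1.
split.
  exact: (derivable_under_integral measurable_01 Ia intf derf (fun=> C0) intC ub).
rewrite -derive1E (differentiation_under_integral measurable_01 Ia intf derf (fun=>
  C0) intC ub).
by apply: eq_Rintegral => x _; rewrite d1.
Qed.

End UnitIntervalIntegral.

(** * Real harmonics and the peaked kernel *)

Section Harmonics.
Variable R : realType.
Implicit Types (f g : R -> R) (k m : int) (th x : R).

Definition freq k : R := 2 * pi * k%:~R.

(** With a free phase, one real family contains cosines and sines; differentiation shifts the phase
    by pi / 2, and products are sums of two members. *)
Definition harm k th x : R := cos (freq k * x + th).

Lemma harmM k m th th' x : harm k th x * harm m th' x =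
  2^-1 * (harm (k + m) (th + th') x + harm (k - m) (th - th') x).
Proof.
rewrite /harm /freq intrD intrB.
set a := 2 * pi * k%:~R * x + th; set b := 2 * pi * m%:~R * x + th'.
rewrite (_ : _ * (k%:~R + m%:~R) * x + _ = a + b); last by rewrite /a /b; ring.
rewrite (_ : _ * (k%:~R - m%:~R) * x + _ = a - b); last by rewrite /a /b; ring.
by rewrite (cosD a b) (cosB a b); field.
Qed.

Lemma harmN k th x : harm (- k) th x = harm k (- th) x.
Proof. by rewrite /harm /freq mulrNz -cosN; congr cos; ring. Qed.

Lemma is_derive_harm k th x :
  is_derive x 1 (harm k th) (freq k * harm k (th + pi / 2) x).
Proof.
have lin : is_derive x 1 (fun y => freq k * y + th) (freq k).
  have -> : (fun y => freq k * y + th) = (freq k \*: (@id R)) + cst th.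
    by apply/funext.
  by apply: is_derive_eq; rewrite addr0 /GRing.scale /= mulr1.
have cosd : is_derive (freq k * x + th) 1 (@cos R) (- sin (freq k * x + th)).
  exact: is_derive_cos.
have := @is_derive1_comp R (@cos R) (fun y => freq k * y + th) x _ _ cosd lin.
by rewrite /harm addrA cosDpihalf mulrC.
Qed.

Lemma derivable_continuous f (df : R -> R) :
  (forall x, is_derive x 1 f (df x)) -> continuous f.
Proof.
move=> dF x; apply: differentiable_continuous; apply/derivable1_diffP.
by have [] := dF x.
Qed.

Lemma continuous_harm k th : continuous (harm k th).
Proof.
apply: (@derivable_continuous (harm k th) (fun x => freq k * harm k (th + pi / 2) x)).
by move=> x; exact: is_derive_harm.
Qed.

Lemma harm_le1 k th x : `|harm k th x| <= 1.
Proof. exact: cos_max. Qed.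

Lemma cos_int k th : cos (2 * pi * k%:~R + th) = cos th.
Proof.
have nat_case (n : nat) (t : R) : cos (2 * pi * n%:R + t) = cos t.
  have e : 2 * pi * n%:R + t = t + (pi *+ 2) *+ n.
    by rewrite -[in RHS]mulr_natr -[pi *+ 2]mulr_natr; ring.
  by rewrite e; have := periodicn (@cosD2pi R) n t.
case: k => n; first exact: nat_case.
rewrite -cosN -[RHS]cosN -(nat_case n.+1 (- th)); congr cos.
by rewrite NegzE mulrNz; ring.
Qed.

Lemma harmD1 k th x : harm k th (x + 1) = harm k th x.
Proof.
rewrite /harm -[RHS](cos_int k); congr cos; rewrite /freq; ring.
Qed.

Lemma int01_harm k th : int01 (harm k th) = if k == 0 then cos th else 0.
Proof.
have [->|k0] := eqVneq k 0.
  rewrite -[RHS]int01_cst; congr int01; apply/funext => x.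
  by rewrite /harm /freq mulr0 mul0r add0r.
have f0 : freq k != 0 by rewrite /freq !mulf_neq0 ?intr_eq0 // gt_eqF // pi_gt0.
have dG x : is_derive x 1 ((freq k)^-1 \*: harm k (th - pi / 2)) (harm k th x).
  have := is_derive_harm k (th - pi / 2) x => dh.
  by apply: is_derive_eq; rewrite /GRing.scale /= subrK mulrA mulVf // mul1r.
have e1 := harmD1 k (th - pi / 2) 0; rewrite add0r in e1.
by rewrite (int01_FTC (@continuous_harm k th) dG) /GRing.scale /= e1 subrr.
Qed.

Lemma continuousM2 f g : continuous f -> continuous g -> continuous (fun x =>
  f x * g x).
Proof. by move=> cf cg x; apply: continuousM; [exact: cf|exact: cg]. Qed.

Lemma continuousD2 f g : continuous f -> continuous g -> continuous (fun x =>
  f x + g x).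
Proof. by move=> cf cg x; apply: continuousD; [exact: cf|exact: cg]. Qed.

Lemma continuousZ2 (c : R) f : continuous f -> continuous (fun x => c * f x).
Proof. by move=> cf; apply: continuousM2 => //; exact: cst_continuous. Qed.

Lemma continuousX2 f (n : nat) : continuous f -> continuous (fun x => f x ^+ n).
Proof.
move=> cf; elim: n => [|n IHn]; first exact: cst_continuous.
under eq_fun do rewrite exprS; exact: continuousM2.
Qed.

(** Since products of harmonics are sums of harmonics, orthogonality to all of them survives
    multiplication by c + [harm 1 th0], and hence by its powers. *)
Lemma int01_harm_expr g (c th0 : R) : continuous g ->
  (forall k th, int01 (fun x => g x * harm k th x) = 0) ->
  forall (n : nat) k th,
  int01 (fun x => g x * (c + harm 1 th0 x) ^+ n * harm k th x) = 0.
Proof.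
move=> cg g0; elim=> [|n IHn] k th.
  by rewrite -[RHS](g0 k th); congr int01; apply/funext => x; rewrite expr0 mulr1.
pose h x := g x * (c + harm 1 th0 x) ^+ n.
have ch : continuous h.
  apply: continuousM2 => //; apply: continuousX2.
  by apply: continuousD2; [exact: cst_continuous|exact: continuous_harm].
have -> : (fun x => g x * (c + harm 1 th0 x) ^+ n.+1 * harm k th x) =
  (fun x => c * (h x * harm k th x) + (2^-1 * (h x * harm (1 + k) (th0 + th) x) +
     2^-1 * (h x * harm (1 - k) (th0 - th) x))).
  apply/funext => x.
  transitivity (c * (h x * harm k th x) + h x * (harm 1 th0 x * harm k th x)).
    by rewrite /h exprSr; ring.
  by rewrite harmM; ring.
have chh k' th' : continuous (fun x => h x * harm k' th' x).
  by apply: continuousM2 => //; exact: continuous_harm.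
rewrite int01D; last 2 first.
  exact: continuousZ2.
  by apply: continuousD2; exact: continuousZ2.
rewrite int01D; last 2 first.
  exact: continuousZ2.
  exact: continuousZ2.
by rewrite !int01Z // !IHn !mulr0 !addr0.
Qed.

(** On [0, 1] the bounds on d place |x - x0| between d and 1 - d; the symmetry t -> 1 - t then
    reduces to the half period on which the cosine decreases. *)
Lemma harm_kernel_le0 (x0 d x : R) : 0 < d -> d <= x0 -> d <= 1 - x0 ->
  x \in `[0, 1] -> d <= `|x - x0| -> cos (2 * pi * (x - x0)) <= cos (2 * pi * d).
Proof.
move=> d0 dx0 dx1; rewrite in_itv /= => /andP[x0' x1'] dx.
have p0 : 0 < pi :> R := pi_gt0 R.
have key t : d <= t -> t <= 1 - d -> cos (2 * pi * t) <= cos (2 * pi * d).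
  move=> dt t1.
  have half s : d <= s -> s <= 2^-1 -> cos (2 * pi * s) <= cos (2 * pi * d).
    move=> ds s2; rewrite leNgt ltr_cos ?in_itv /= -?leNgt.
    - nra.
    - apply/andP; split; nra.
    - apply/andP; split; nra.
  have [t2|t2] := leP t 2^-1; first exact: half.
  have -> : cos (2 * pi * t) = cos (2 * pi * (1 - t)).
    rewrite -cosN -(cos_int 1); congr cos; rewrite mulr1z; ring.
  apply: half; lra.
have [xx|xx] := leP x0 x.
  by apply: key; move: dx; rewrite ger0_norm; lra.
rewrite -cosN -mulrN opprB; apply: key; move: dx; rewrite ltr0_norm; lra.
Qed.

(* If g x0 > 0, test g against the powers of 1 + kap with
   kap x = cos (2 pi (x - x0)) - cos (2 pi d): by Bernoulli's inequality the
   integral near x0 grows without bound, while it stays bounded elsewhere. *)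
Lemma harm_orthogonal_le0 g (x0 : R) : continuous g ->
  (forall k th, int01 (fun x => g x * harm k th x) = 0) ->
  x0 \in `]0, 1[ -> g x0 <= 0.
Proof.
move=> cg g0 x01; rewrite leNgt; apply/negP => gx0.
have p0 : 0 < pi :> R := pi_gt0 R.
move: (x01); rewrite in_itv /= => /andP[x00 x0l].
have : \forall x \near x0, g x0 / 2 < g x.
  near=> x; near: x; apply: (cvgr_gt (g x0)); [exact: cg|lra].
case=> d' /= d'0 Hd'.
(* The term d' / 2 keeps g above half of g x0, the terms x0 and 1 - x0 serve [harm_kernel_le0], and
   1/4 keeps 2 pi d inside [0, pi]. *)
pose d := Num.min (d' / 2) (Num.min (Num.min x0 (1 - x0)) 4^-1).
have d0 : 0 < d by rewrite /d !lt_min; apply/andP; split; [lra|apply/andP; split;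
  [apply/andP; split; lra|lra]].
have : d <= d by [].
rewrite {2}/d !le_min => /andP[dd' /andP[/andP[dx0 dx1] d4]].
pose e := g x0 / 2; have e0 : 0 < e by rewrite /e; lra.
have inner x : `|x - x0| < d -> e <= g x.
  by move=> xd; apply/ltW/Hd' => /=; rewrite distrC; lra.
have [B Bg] : exists B : R, forall x, x \in `[0, 1] -> `|g x| <= B.
  have := @EVT_max R (fun x => `|g x|) 0 1 ler01.
  case=> [|c _ Hc]; last by exists `|g c|.
  apply: continuous_subspaceT => x; apply: continuous_comp; first exact: cg.
  exact: norm_continuous.
have B0 : 0 <= B.
  by apply: le_trans (normr_ge0 _) (Bg x0 _); rewrite in_itv /= !ltW.
(* Chosen so that c + [harm 1 th] is 1 + [kap]. *)
pose c := 1 - cos (2 * pi * d).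
pose th := - (2 * pi * x0).
have hE x : harm 1 th x = cos (2 * pi * (x - x0)).
  by rewrite /harm /freq mulr1z; congr cos; rewrite /th; ring.
pose kap x := harm 1 th x - cos (2 * pi * d).
(* Positive part of [kap], which carries the gain from Bernoulli's inequality. *)
pose kapp x := (kap x + `|kap x|) / 2.
have ckap : continuous kap.
  by apply: continuousD2; [exact: continuous_harm|exact: cst_continuous].
have ckapp : continuous kapp.
  apply: continuousM2; last exact: cst_continuous.
  apply: continuousD2 => // x; apply: continuous_comp; first exact: ckap.
  exact: norm_continuous.
have kapp0 x : 0 <= kapp x by rewrite /kapp; have := ler_norm (- kap x);
  rewrite normrN; lra.
have Ikapp : 0 < int01 kapp.
  apply: (int01_gt0 ckapp _ x01) => // ; rewrite /kapp /kap hE subrr mulr0 cos0.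
  have cd : cos (2 * pi * d) < 1.
    rewrite -[X in _ < X](@cos0 R) ltr_cos ?in_itv /=; [nra| |].
      by rewrite lexx ltW.
    by apply/andP; split; nra.
  by rewrite ger0_norm; lra.
(* Integrated form of - B + 2 n e [kapp] <= g (1 + [kap])^(2 n), whose right side has integral 0.
   The even exponent keeps the power nonnegative where [kap] <= 0 near x0. *)
have key n : - B + (2 * n%:R * e) * int01 kapp <= 0.
  have := int01_harm_expr c th cg g0 (2 * n)%N 0 0.
  have -> : (fun x => g x * (c + harm 1 th x) ^+ (2 * n) * harm 0 0 x) =
      (fun x => g x * (1 + kap x) ^+ (2 * n)).
    apply/funext => x; rewrite {2}/harm /freq !mulr0 mul0r addr0 cos0 mulr1.
    by congr (_ * _ ^+ _); rewrite /c /kap; ring.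
  move=> <-.
  rewrite -int01Z // -[X in X + _](int01_cst (- B)) -int01D; last 2 first.
    exact: cst_continuous.
    exact: continuousZ2.
  apply: le_int01.
  - by apply: continuousD2; [exact: cst_continuous|exact: continuousZ2].
  - apply: continuousM2 => //; apply: continuousX2.
    by apply: continuousD2 => //; exact: cst_continuous.
  move=> x xI.
  have gB : - B <= g x by have := Bg x xI; rewrite ler_norml => /andP[].
  have [xd|xd] := ltP `|x - x0| d.
    have gx := inner x xd.
    have [k0|k0] := leP (kap x) 0.
      rewrite /kapp ler0_norm // subrr mul0r mulr0 addr0.
      apply: le_trans (_ : 0 <= _); first lra.
      by rewrite mulr_ge0 ?exprn_even_ge0 //; [lra|rewrite oddM].
    rewrite /kapp gtr0_norm //.
    have bern : 1 + (2 * n)%:R * kap x <= (1 + kap x) ^+ (2 * n).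
      elim: (2 * n)%N => [|j IHj]; first by rewrite mul0r addr0 expr0.
      rewrite exprS -natr1.
      have : (1 + kap x) * (1 + j%:R * kap x) <= (1 + kap x) * (1 + kap x) ^+ j.
        by rewrite ler_wpM2l //; lra.
      have : 0 <= j%:R :> R by [].
      nra.
    have : e * (1 + (2 * n)%:R * kap x) <= g x * (1 + kap x) ^+ (2 * n).
      have nn : 0 <= (2 * n)%:R :> R by [].
      by apply: ler_pM => //; nra.
    rewrite natrM.
    have nn : 0 <= n%:R :> R by [].
    nra.
  have k0 : kap x <= 0.
    by rewrite /kap hE subr_le0; apply: harm_kernel_le0.
  rewrite /kapp ler0_norm // subrr mul0r mulr0 addr0.
  have K1 : `|1 + kap x| <= 1.
    rewrite ler_norml; apply/andP; split; last lra.
    rewrite /kap; have := cos_geN1 (freq 1 * x + th); have := cos_le1 (2 * pi * d).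
    rewrite -/(harm 1 th x); lra.
  have Kn : `|(1 + kap x) ^+ (2 * n)| <= 1.
    by rewrite normrX; apply: exprn_ile1.
  have : `|g x * (1 + kap x) ^+ (2 * n)| <= B.
    by rewrite normrM -[B]mulr1 ler_pM // Bg.
  by rewrite ler_norml => /andP[].
pose q := 2 * e * int01 kapp.
have q0 : 0 < q by rewrite /q !mulr_gt0.
have [n Hn] : exists n : nat, B / q < n%:R.
  by exists (Num.truncn (B / q)).+1; apply: truncnS_gt.
have := key n; rewrite (_ : _ * int01 kapp = n%:R * q); last by rewrite /q; ring.
by move: Hn; rewrite ltr_pdivrMr //; lra.
Unshelve. all: by end_near. Qed.

End Harmonics.

(** * Completeness of the harmonics and finite Fourier expansions *)

Section FourierExpansion.
Variable R : realType.
Implicit Types (f g : R -> R) (k : int) (th x : R).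

Definition period1 g := forall x, g (x + 1) = g x.

Lemma period1_int g k x : period1 g -> g (x + k%:~R) = g x.
Proof.
move=> pg; have nat_case (n : nat) (t : R) : g (t + n%:R) = g t.
  elim: n => [|n IHn]; first by rewrite addr0.
  by rewrite -natr1 addrA pg.
case: k => n; first exact: nat_case.
by rewrite -(nat_case n.+1) NegzE mulrNz -addrA addNr addr0.
Qed.

(** The one-sided bound for g and for - g settles the open unit interval, continuity the point 0,
    and periodicity the rest. *)
Lemma harm_orthogonal_eq0 g : continuous g -> period1 g ->
  (forall k th, int01 (fun x => g x * harm k th x) = 0) -> forall x, g x = 0.
Proof.
move=> cg pg g0.
have inside x : x \in `]0, 1[ -> g x = 0.
  move=> x01; apply/eqP; rewrite eq_le (harm_orthogonal_le0 cg g0 x01) /=.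
  have cNg : continuous (fun x => - g x) by move=> y; apply: cvgN; exact: cg.
  rewrite -oppr_le0; apply: (harm_orthogonal_le0 cNg _ x01) => k th.
  rewrite -[RHS](mulr0 (-1)) -(g0 k th) -int01Z; last first.
    by apply: continuousM2 => //; exact: continuous_harm.
  by congr int01; apply/funext => y; ring.
have at0 : g 0 = 0.
  apply/eqP; apply/negPn/negP => g00.
  have : \forall x \near (0 : R), `|g 0 - g x| < `|g 0|.
    near=> x; near: x; move/cvgrPdist_lt: (cg 0); apply; by rewrite normr_gt0.
  case=> d /= d0 Hd.
  pose y := Num.min (d / 2) (2^-1).
  have y0 : 0 < y by rewrite /y lt_min; apply/andP; split; lra.
  have : y <= y by [].
  rewrite {2}/y le_min => /andP[yd y2].
  have gy : g y = 0 by apply: inside; rewrite in_itv /=; apply/andP; split; lra.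
  have : `|0 - y| < d by rewrite sub0r normrN gtr0_norm //; lra.
  by move=> /Hd /=; rewrite gy subr0 ltxx.
move=> x; rewrite -(period1_int (- Num.floor x) x pg) mulrNz.
have /andP[x0 x1] := floor_itv x.
have [e|ne] := eqVneq x (Num.floor x)%:~R.
  by rewrite {1}e subrr.
have xf : (Num.floor x)%:~R < x by rewrite lt_neqAle eq_sym ne.
by apply: inside; rewrite in_itv /=; move: x1; rewrite intrD mulr1z => x1;
  apply/andP; split; lra.
Unshelve. all: by end_near. Qed.

(* The phase pi/2 turns cosine into minus sine. *)
Definition phase (b : bool) : R := if b then pi / 2 else 0.

(** Inverse of the mean square of a harmonic: 1/2 for positive frequencies, 1 for the constant. *)
Definition mult (m : nat) : R := if m is 0%N then 1 else 2.

Definition fcoef g (m : nat) (b : bool) : R :=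
  mult m * int01 (fun x => g x * harm m (phase b) x).

Definition fpartial g (M : nat) x : R :=
  \sum_(m < M.+1) \sum_(b : bool) fcoef g m b * harm m (phase b) x.

Lemma continuous_sumT (I : finType) (F : I -> R -> R) :
  (forall i, continuous (F i)) -> continuous (fun x => \sum_i F i x).
Proof.
move=> cF x; rewrite /index_enum; elim: (Finite.enum I) => [|i r IHr].
  have -> : (fun x => \sum_(i <- [::]) F i x) = cst 0.
    by apply/funext => y; rewrite big_nil.
  exact: cst_continuous.
have -> : (fun x => \sum_(j <- i :: r) F j x) = (fun x => F i x + \sum_(j <- r) F j x).
  by apply/funext => y; rewrite big_cons.
by apply: cvgD; [exact: cF|exact: IHr].
Qed.

Lemma continuous_fpartial g M : continuous (fpartial g M).
Proof.
apply: continuous_sumT => m; apply: continuous_sumT => b.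
by apply: continuousZ2; exact: continuous_harm.
Qed.

Lemma harm_split k th x :
  harm k th x = cos th * harm k (phase false) x + sin th * harm k (phase true) x.
Proof.
by rewrite /harm /phase addr0 cosDpihalf cosD mulrN; ring.
Qed.

Lemma int01_harm_split g k th : continuous g ->
  int01 (fun x => g x * harm k th x) =
  cos th * int01 (fun x => g x * harm k (phase false) x) +
  sin th * int01 (fun x => g x * harm k (phase true) x).
Proof.
move=> cg; have ch th' : continuous (fun x => g x * harm k th' x).
  by apply: continuousM2 => //; exact: continuous_harm.
rewrite -!int01Z // -int01D; last 2 first.
  exact: continuousZ2.
  exact: continuousZ2.
by congr int01; apply/funext => x; rewrite (harm_split k th); ring.
Qed.

(** Orthogonality relations. The exceptional value 0 on the diagonal occurs for m = 0 with phase pi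
    / 2, where the harmonic is identically zero. *)
Lemma int01_harmM (m n : nat) (b c : bool) :
  mult m * int01 (fun x => harm m (phase b) x * harm n (phase c) x) =
  if (m == n) && (b == c) then (if (m == 0%N) && b then 0 else 1) else 0.
Proof.
have ch k th : continuous (fun x => 2^-1 * harm k th x :> R).
  by apply: continuousZ2; exact: continuous_harm.
have -> : (fun x => harm m (phase b) x * harm n (phase c) x) =
   (fun x => 2^-1 * harm (m%:Z + n%:Z) (phase b + phase c) x +
             2^-1 * harm (m%:Z - n%:Z) (phase b - phase c) x).
  by apply/funext => x; rewrite harmM mulrDr.
rewrite int01D // !int01Z; [|exact: continuous_harm..].
have e1 : (m%:Z + n%:Z == 0) = (m == 0%N) && (n == 0%N).
  by rewrite -PoszD -addn_eq0.
have e2 : (m%:Z - n%:Z == 0) = (m == n) by rewrite subr_eq0.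
rewrite !int01_harm e1 e2 {e1 e2 ch}.
have c00 : cos (pi / 2 + pi / 2 : R) = -1.
  by rewrite -[RHS]cospi; congr cos; field.
have [<-|mn] := eqVneq m n.
  rewrite andbb.
  by case: m => [|m] /=; case: b; case: c => /=; rewrite /phase ?addr0 ?add0r
    ?subrr ?sub0r ?subr0 ?cosN ?c00 ?cos_pihalf ?cos0 //; field.
case: m n mn => [|m] [|n] //= _; rewrite !mulr0 ?addr0 ?mulr0 //.
Qed.

(** The remainder g - [fpartial g M] is orthogonal to the harmonics up to M by the choice of
    coefficients and to those beyond M by hypothesis, so completeness makes it zero. *)
Lemma fpartialE g M : continuous g -> period1 g ->
  (forall (m : nat) th, (M < m)%N -> int01 (fun x => g x * harm m th x) = 0) ->
  forall x, g x = fpartial g M x.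
Proof.
move=> cg pg gM x; apply/eqP; rewrite -subr_eq0; apply/eqP.
pose r y := g y + (-1) * fpartial g M y.
have cr : continuous r.
  by apply: continuousD2 => //; apply: continuousZ2; exact: continuous_fpartial.
have pr : period1 r.
  move=> y; rewrite /r pg /fpartial; congr (_ + _ * _).
  by apply: eq_bigr => m _; apply: eq_bigr => b _; rewrite harmD1.
suff r0 : forall k th, int01 (fun x => r x * harm k th x) = 0.
  by have := harm_orthogonal_eq0 cr pr r0 x; rewrite /r mulN1r.
have basic (n : nat) (c : bool) : int01 (fun x => r x * harm n (phase c) x) = 0.
  have ch (m : nat) (b : bool) :
      continuous (fun y => harm m (phase b) y * harm n (phase c) y).
    by apply: continuousM2; exact: continuous_harm.
  have -> : (fun x => r x * harm n (phase c) x) =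
     (fun y => g y * harm n (phase c) y + (-1) * \sum_(m < M.+1) \sum_(b : bool)
       fcoef g m b * (harm m (phase b) y * harm n (phase c) y)).
    apply/funext => y; rewrite /r mulrDl -mulrA; congr (_ + _ * _).
    rewrite /fpartial mulr_suml; apply: eq_bigr => m _.
    by rewrite mulr_suml; apply: eq_bigr => b _; rewrite mulrA.
  have cs (m : 'I_M.+1) : continuous (fun y => \sum_(b : bool)
       fcoef g m b * (harm m (phase b) y * harm n (phase c) y)).
    by apply: continuous_sumT => b; exact: continuousZ2.
  rewrite int01D; last 2 first.
    by apply: continuousM2 => //; exact: continuous_harm.
    by apply: continuousZ2; apply: continuous_sumT.
  rewrite int01Z; last by apply: continuous_sumT.
  rewrite int01_sum //.
  have E : \sum_(m < M.+1) int01 (fun y => \sum_(b : bool)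
      fcoef g m b * (harm m (phase b) y * harm n (phase c) y)) =
      \sum_(m < M.+1) \sum_(b : bool)
       int01 (fun y => g y * harm m (phase b) y) *
       (if (m == n :> nat) && (b == c) then (if (m == 0%N :> nat) && b then 0 else 1)
         else 0).
    apply: eq_bigr => m _; rewrite int01_sum; last by move=> b; exact: continuousZ2.
    apply: eq_bigr => b _; rewrite int01Z // /fcoef mulrAC -mulrA -int01_harmM; ring.
  rewrite E {E}.
  have [nM|nM] := leqP n M; last first.
    rewrite gM // add0r big1 ?mulr0 // => m _; rewrite big1 // => b _.
    by case: eqP => [mn|]; [move: nM; rewrite -mn ltnNge -ltnS ltn_ord|rewrite /=
      mulr0].
  have nM' : (n < M.+1)%N by [].
  rewrite (bigD1 (Ordinal nM')) //= [X in -1 * (_ + X)]big1 ?addr0; last first.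
    move=> m mn; rewrite big1 // => b _; rewrite ifF ?mulr0 //.
    by rewrite -(inj_eq val_inj) /= in mn; rewrite (negPf mn).
  rewrite (bigD1 c) //= big1 ?addr0; last first.
    by move=> b bc; rewrite (negPf bc) andbF mulr0.
  rewrite !eqxx /=; case: ifP => [/andP[/eqP-> ->]|_]; last by ring.
  rewrite mulr0 mulr0 addr0 -[RHS](int01_cst 0); congr int01; apply/funext => y.
  by rewrite /harm /freq mulr0 mul0r add0r cos_pihalf mulr0.
move=> k th.
have nat_case (n : nat) th' : int01 (fun x => r x * harm n th' x) = 0.
  by rewrite int01_harm_split // !basic !mulr0 addr0.
case: k => n; first exact: nat_case.
rewrite -(nat_case n.+1 (- th)); congr int01; apply/funext => y.
by rewrite NegzE harmN.
Qed.

(** Integrating in x the finite expansion in y shows that the coefficients in x are again finite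
    sums in y; this turns two simple expansions into a double one. *)
Lemma int01_fpartial (f : R -> R -> R) M (m : nat) (b : bool) y :
  (forall x, f x y = fpartial (f x) M y) ->
  (forall n c, continuous (fun x => fcoef (f x) n c)) ->
  fcoef (f ^~ y) m b =
  \sum_(n < M.+1) \sum_(c : bool)
    fcoef (fun x => fcoef (f x) n c) m b * harm n (phase c) y.
Proof.
move=> fE cf; rewrite {1}/fcoef.
have -> : (fun x => f x y * harm m (phase b) x) =
  (fun x => \sum_(n < M.+1) \sum_(c : bool)
     harm n (phase c) y * (fcoef (f x) n c * harm m (phase b) x)).
  apply/funext => x; rewrite fE /fpartial mulr_suml; apply: eq_bigr => n _.
  by rewrite mulr_suml; apply: eq_bigr => c _; ring.
have c1 (n : nat) c : continuous (fun x => fcoef (f x) n c * harm m (phase b) x).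
  by apply: continuousM2 => //; exact: continuous_harm.
rewrite int01_sum; last first.
  by move=> n; apply: continuous_sumT => c; exact: continuousZ2.
rewrite mulr_sumr; apply: eq_bigr => n _.
rewrite int01_sum; last by move=> c; exact: continuousZ2.
rewrite mulr_sumr; apply: eq_bigr => c _.
by rewrite int01Z // [in RHS]/fcoef; ring.
Qed.

(* (u u')' = u'^2 + c u^2 >= 0, so the periodic function u u' is constant. *)
Lemma periodic_growth_eq0 (u u' : R -> R) (c : R) : 0 < c ->
  (forall y : R, is_derive y 1 u (u' y)) ->
  (forall y : R, is_derive y 1 u' (c * u y)) ->
  period1 u -> period1 u' -> forall y, u y = 0.
Proof.
move=> c0 du du' pu pu' y.
pose V : R -> R := u * u'.
have dV (t : R) : is_derive t 1 V (u' t ^+ 2 + c * u t ^+ 2).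
  have dut := du t; have du't := du' t.
  by apply: is_derive_eq; rewrite /GRing.scale /=; ring.
have V'0 t : 0 <= u' t ^+ 2 + c * u t ^+ 2.
  by rewrite addr_ge0 ?sqr_ge0 // mulr_ge0 ?sqr_ge0 // ltW.
have cV : continuous V by exact: (derivable_continuous dV).
have ndV a b : a <= b -> V a <= V b.
  move=> ab; have [->//|ne] := eqVneq a b.
  apply: (@ger0_derive1_le_cc R V a b) => //.
  - move=> t _; rewrite derive1E (@derive_val _ _ _ _ _ _ _ (dV t)); exact: V'0.
  - exact: continuous_subspaceT.
  - by rewrite bound_itvE.
  - by rewrite bound_itvE.
have pV : period1 V by move=> t; rewrite /V /GRing.mul /= pu pu'.
have cstV z t : z <= t <= z + 1 -> V t = V z.
  by move=> /andP[yt t1]; apply/le_anti/andP; split; [rewrite -(pV z)|]; exact: ndV.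
pose z := y - 2^-1.
have yz : y \in `]z, z + 1[ by rewrite in_itv /=; apply/andP; split; rewrite /z; lra.
have dV0 : is_derive y 1 V 0.
  apply: (near_eq_is_derive (f := cst (V z))).
  - near=> s; rewrite (cstV z) //.
    have : s \in `]z, z + 1[ by near: s; exact: near_in_itvoo.
    by rewrite in_itv /= => /andP[? ?]; apply/andP; split; exact: ltW.
have := dV y; move=> /@derive_val; have := dV0 => /@derive_val -> /esym/eqP.
rewrite paddr_eq0 ?sqr_ge0 //; last by rewrite mulr_ge0 ?sqr_ge0 // ltW.
move=> /andP[_].
by rewrite mulf_eq0 gt_eqF //= sqrf_eq0 => /eqP.
Unshelve. all: by end_near. Qed.

End FourierExpansion.

(** * Eigenfunctions are trigonometric polynomials *)

Section PeriodicEigenfunctions.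
Variable R : realType.
Variable E : R.
Implicit Types (F Fx Fy Fxx Fyy : R -> R -> R).

Definition bounded2 F := exists C : R, forall x y, `|F x y| <= C.

(** Regularity and periodicity seen from the first variable; with the arguments exchanged the same
    record describes the second, so the lemmas serve both. *)
Record half_eigen F Fx Fxx : Prop := HalfEigen {
  half_d : forall x y : R, is_derive x 1 (F ^~ y) (Fx x y);
  half_dd : forall x y : R, is_derive x 1 (Fx ^~ y) (Fxx x y);
  half_per : forall y, period1 (F ^~ y);
  half_bd : bounded2 Fx;
  half_bdd : bounded2 Fxx;
  half_c : forall y, continuous (Fxx ^~ y);
  half_c1 : forall x, continuous (Fx x);
  half_c2 : forall x, continuous (Fxx x) }.

Lemma period1_derive (f f' : R -> R) :
  (forall x : R, is_derive x 1 f (f' x)) -> period1 f -> period1 f'.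
Proof.
move=> df pf x.
have ds : is_derive x 1 (fun t : R => t + 1) 1.
  have -> : (fun t : R => t + 1) = @id R + cst 1 by apply/funext.
  by apply: is_derive_eq; rewrite addr0.
have d1 := @is_derive1_comp R f (fun t => t + 1) x _ _ (df (x + 1)) ds.
have e : f \o (fun t => t + 1) = f by apply/funext => t; exact: pf.
rewrite e mulr1 in d1.
by rewrite -(@derive_val _ _ _ _ _ _ _ d1) (@derive_val _ _ _ _ _ _ _ (df x)).
Qed.

(** Two integrations by parts in one: for a harmonic h, the function Fx h - F h' has derivative Fxx
    h + freq^2 F h and equal values at 0 and 1. *)
Lemma int01_ddx_harm F Fx Fxx k th y : half_eigen F Fx Fxx ->
  int01 (fun x => Fxx x y * harm k th x) =
  - freq R k ^+ 2 * int01 (fun x => F x y * harm k th x).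
Proof.
move=> H; set w := freq R k.
have cF : continuous (F ^~ y) := derivable_continuous (fun x => half_d H x y).
have cFx : continuous (Fx ^~ y) := derivable_continuous (fun x => half_dd H x y).
have ch := @continuous_harm R k th.
have W (x : R) : is_derive x 1 ((Fx ^~ y) * harm k th - (F ^~ y) * (w \*: harm k (th
  + pi / 2)))
    (Fxx x y * harm k th x + w ^+ 2 * (F x y * harm k th x)).
  have d1 := half_d H x y; have d2 := half_dd H x y.
  have d3 := is_derive_harm k th x; have d4 := is_derive_harm k (th + pi / 2) x.
  apply: is_derive_eq; rewrite /GRing.scale /= -/w.
  have -> : harm k (th + pi / 2 + pi / 2) x = - harm k th x.
    by rewrite /harm !addrA cosDpihalf sinDpihalf.
  rewrite /GRing.scale /=; ring.
have cFh : continuous (fun x => F x y * harm k th x) by exact: continuousM2.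
have cFxxh : continuous (fun x => Fxx x y * harm k th x).
  by apply: continuousM2 => //; exact: half_c H y.
have cW : continuous (fun x => Fxx x y * harm k th x + w ^+ 2 * (F x y * harm k th x)).
  by apply: continuousD2 => //; exact: continuousZ2.
have := int01_FTC cW W.
rewrite int01D ?int01Z //; last exact: continuousZ2.
have per1 g : period1 g -> g 1 = g 0 by move=> pg; rewrite -(pg 0) add0r.
have pFx := period1_derive (fun x => half_d H x y) (half_per H y).
have -> : ((Fx ^~ y) * harm k th - (F ^~ y) * (w \*: harm k (th + pi / 2))) 1 -
  ((Fx ^~ y) * harm k th - (F ^~ y) * (w \*: harm k (th + pi / 2))) 0 = 0.
  apply/eqP; rewrite subr_eq0; apply/eqP; apply: per1 => x.
  by rewrite !fctE /= pFx (half_per H y) !harmD1.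
by move/eqP; rewrite addr_eq0 mulNr => /eqP.
Qed.

Lemma is_derive_int01_harm F Fy k th (y : R) :
  (forall x y : R, is_derive y 1 (F x) (Fy x y)) -> bounded2 Fy ->
  (forall y, continuous (F ^~ y)) ->
  is_derive y 1 (fun y => int01 (fun x => F x y * harm k th x))
    (int01 (fun x => Fy x y * harm k th x)).
Proof.
move=> dF [C bF] cF.
apply: (@int01_is_derive R (fun y x => F x y * harm k th x)
  (fun y x => Fy x y * harm k th x)).
- move=> t x; have d := dF x t.
  have -> : (fun t => F x t * harm k th x) = harm k th x \*: F x.
    by apply/funext => s; rewrite /GRing.scale /= mulrC.
  by apply: is_derive_eq; rewrite /GRing.scale /= mulrC.
- by move=> t; apply: continuousM2 => //; exact: continuous_harm.
- exists C => t x; rewrite normrM -[C]mulr1; apply: ler_pM => //.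
  exact: harm_le1.
Qed.

Variables (F Fx Fy Fxx Fyy : R -> R -> R).
Hypothesis HX : half_eigen F Fx Fxx.
Hypothesis HY : half_eigen (fun y x => F x y) (fun y x => Fy x y) (fun y x => Fyy x y).
Hypothesis lap : forall x y, Fxx x y + Fyy x y = - E * F x y.

Lemma int01_harm_vanish k th y : E < freq R k ^+ 2 ->
  int01 (fun x => F x y * harm k th x) = 0.
Proof.
move=> Ek.
have cF z : continuous (F ^~ z) := derivable_continuous (fun x => half_d HX x z).
have ch := @continuous_harm R k th.
have bsw G : bounded2 (fun y x => G x y) -> bounded2 G.
  by case=> C b; exists C => a b'; exact: b.
pose u y := int01 (fun x => F x y * harm k th x).
pose u' y := int01 (fun x => Fy x y * harm k th x).
apply: (@periodic_growth_eq0 R u u' (freq R k ^+ 2 - E)).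
- by rewrite subr_gt0.
- move=> z; apply: is_derive_int01_harm.
  + by move=> x t; exact: (half_d HY).
  + exact/bsw/(half_bd HY).
  + exact: cF.
- move=> z; have := @is_derive_int01_harm Fy Fyy k th z.
  have -> : int01 (fun x => Fyy x z * harm k th x) = (freq R k ^+ 2 - E) * u z.
    have -> : (fun x => Fyy x z * harm k th x) =
       (fun x => - E * (F x z * harm k th x) + (-1) * (Fxx x z * harm k th x)).
      apply/funext => x; have -> : Fyy x z = - E * F x z - Fxx x z
        by rewrite -(lap x z); ring.
      ring.
    have c1 : continuous (fun x => F x z * harm k th x) by exact: continuousM2.
    have c2 : continuous (fun x => Fxx x z * harm k th x).
      by apply: continuousM2 => //; exact: (half_c HX).
    rewrite int01D; last 2 first.
      exact: continuousZ2.
      exact: continuousZ2.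
    by rewrite !int01Z // (int01_ddx_harm k th z HX) /u; ring.
  apply.
  + by move=> x t; exact: (half_dd HY).
  + exact/bsw/(half_bdd HY).
  + by move=> t; exact: (half_c1 HY).
- by move=> z; rewrite /u; congr int01; apply/funext => x; rewrite (half_per HY).
- move=> z; rewrite /u'; congr int01; apply/funext => x; congr (_ * _).
  exact: (period1_derive (fun t => half_d HY t x) (half_per HY x)).
Qed.

End PeriodicEigenfunctions.

Section Expansion.
Variables (R : realType) (E : R) (F Fx Fy Fxx Fyy : R -> R -> R) (M : nat).
Hypothesis HX : half_eigen F Fx Fxx.
Hypothesis HY : half_eigen (fun y x => F x y) (fun y x => Fy x y) (fun y x => Fyy x y).
Hypothesis lap : forall x y, Fxx x y + Fyy x y = - E * F x y.
Hypothesis hM : forall m : nat, (M < m)%N -> E < freq R m ^+ 2.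

Lemma eigen_expansion : exists a : nat -> bool -> nat -> bool -> R,
  forall x y, F x y = \sum_(m < M.+1) \sum_(b : bool) \sum_(n < M.+1) \sum_(c : bool)
    a m b n c * harm n (phase R c) y * harm m (phase R b) x.
Proof.
have lap' x y : Fyy y x + Fxx y x = - E * F y x by rewrite addrC lap.
have cX y : continuous (F ^~ y) := derivable_continuous (fun x => half_d HX x y).
have cY x : continuous (F x) := derivable_continuous (fun y => half_d HY y x).
have eX x y : F x y = fpartial (F ^~ y) M x.
  apply: fpartialE => //; first exact: half_per HX y.
  by move=> m th /hM Em; exact: (int01_harm_vanish HX HY lap).
have eY x y : F x y = fpartial (F x) M y.
  apply: fpartialE => //; first exact: half_per HY x.
  by move=> m th /hM Em; exact: (int01_harm_vanish HY HX lap').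
(* Coefficients in x of the coefficients in y; the latter are continuous in x, being differentiable
   under the integral. *)
exists (fun m b n c => fcoef (fun x => fcoef (F x) n c) m b) => x y.
rewrite eX /fpartial; apply: eq_bigr => m _; apply: eq_bigr => b _.
rewrite (@int01_fpartial R F M m b y).
- by rewrite mulr_suml; apply: eq_bigr => n _; rewrite mulr_suml.
- by move=> z; exact: eY.
move=> n c; apply: continuousZ2.
apply: (@derivable_continuous R _ (fun x => int01 (fun y =>
  Fx x y * harm n (phase R c) y))).
move=> z; apply: (@is_derive_int01_harm R (fun y x => F x y) (fun y x => Fx x y)).
- by move=> s t; exact: half_d HX t s.
- by have [C b'] := half_bd HX; exists C => s t; exact: b'.
- by move=> t; exact: cY.
Qed.

End Expansion.

(** * Laurent polynomials on the circle *)

Section Circle.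
Local Open Scope complex_scope.
Variable R : realType.
Local Notation K := R[i].
Implicit Types (x y t : R) (u v : R -> K) (p q : {poly K}).

Definition ce x : K := cos (2 * pi * x) +i* sin (2 * pi * x).

Lemma eq_complexP (a b : K) :
  complex.Re a = complex.Re b -> complex.Im a = complex.Im b -> a = b.
Proof. by case: a b => [a1 a2] [b1 b2] /= -> ->. Qed.

Lemma ceD x y : ce (x + y) = ce x * ce y.
Proof.
rewrite /ce mulrDr cosD sinD; apply: eq_complexP => //=.
by rewrite addrC; ring.
Qed.

Lemma ce0 : ce 0 = 1.
Proof. by rewrite /ce mulr0 cos0 sin0. Qed.

Lemma ce_int (k : int) : ce k%:~R = 1.
Proof.
apply: eq_complexP => /=; first by rewrite -[X in cos X]addr0 cos_int cos0.
rewrite -[sin _]opprK -cosDpihalf cos_int cos_pihalf oppr0 //.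
Qed.

Lemma ceDint x (k : int) : ce (x + k%:~R) = ce x.
Proof. by rewrite ceD ce_int mulr1. Qed.

Lemma ce_neq0 x : ce x != 0.
Proof.
apply/eqP => e; have := ceD x (- x); rewrite subrr ce0 e mul0r => /eqP.
by rewrite oner_eq0.
Qed.

Lemma ceX x n : ce x ^+ n = ce (n%:R * x).
Proof.
elim: n => [|n IHn]; first by rewrite expr0 mul0r ce0.
by rewrite exprSr IHn -ceD; congr ce; rewrite -natr1; ring.
Qed.

Lemma ce_eq1 x : ce x = 1 -> exists k : int, x = k%:~R.
Proof.
move=> ex; exists (Num.floor x).
have /andP[f0 f1] := floor_itv x; rewrite intrD mulr1z in f1.
have p0 : 0 < pi :> R := pi_gt0 R.
pose s := x - (Num.floor x)%:~R.
have : ce s = 1 by rewrite /s -mulrNz ceDint.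
move=> /(congr1 (@complex.Re R)) /= cs.
have half t : 0 <= t -> t <= 2^-1 -> cos (2 * pi * t) = 1 -> t = 0.
  move=> t0 t2; rewrite -[RHS](@cos0 R) => /cos_inj h.
  have : 2 * pi * t = 0 by apply: h; rewrite in_itv /=; apply/andP; split; nra.
  by move/eqP; rewrite mulf_eq0 gt_eqF ?mulr_gt0 //= => /eqP.
have [s2|s2] := leP s 2^-1.
  have : s = 0 by apply: half => //; rewrite /s; lra.
  by rewrite /s; lra.
have : 1 - s = 0.
  apply: half; [by rewrite /s; lra|by lra|].
  rewrite -cosN -(cos_int 1) -[RHS]cs; congr cos; rewrite mulr1z; ring.
rewrite /s; lra.
Qed.

Lemma ce_inj x y : ce x = ce y -> exists k : int, x = y + k%:~R.
Proof.
move=> e; have [k kE] : exists k : int, x - y = k%:~R.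
  apply: ce_eq1; apply: (mulIf (ce_neq0 y)).
  by rewrite -ceD subrK mul1r.
by exists k; rewrite -kE addrC subrK.
Qed.

(** Complex identities are differentiated componentwise, and [cder_unique] then compares the two
    sides. *)
Definition cder u x (d : K) :=
  is_derive x 1 (fun t => complex.Re (u t)) (complex.Re d) /\
  is_derive x 1 (fun t => complex.Im (u t)) (complex.Im d).

Lemma cder_unique u x d e : cder u x d -> cder u x e -> d = e.
Proof.
move=> [d1 d2] [e1 e2]; apply: eq_complexP.
  by rewrite -(@derive_val _ _ _ _ _ _ _ d1) (@derive_val _ _ _ _ _ _ _ e1).
by rewrite -(@derive_val _ _ _ _ _ _ _ d2) (@derive_val _ _ _ _ _ _ _ e2).
Qed.

Lemma cder_cst (c : K) x : cder (fun=> c) x 0.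
Proof. by split; apply: is_derive_cst. Qed.

Lemma cderD u v x d e : cder u x d -> cder v x e ->
  cder (fun t => u t + v t) x (d + e).
Proof.
have ReD (a b : K) : complex.Re (a + b) = complex.Re a + complex.Re b
  by case: a b => [? ?] [? ?].
have ImD (a b : K) : complex.Im (a + b) = complex.Im a + complex.Im b
  by case: a b => [? ?] [? ?].
move=> [d1 d2] [e1 e2]; split; rewrite ?ReD ?ImD.
  by under eq_fun do rewrite ReD; exact: is_deriveD.
by under eq_fun do rewrite ImD; exact: is_deriveD.
Qed.

Lemma cderM u v x d e : cder u x d -> cder v x e ->
  cder (fun t => u t * v t) x (d * v x + u x * e).
Proof.
have ReM (a b : K) : complex.Re (a * b) =
  complex.Re a * complex.Re b - complex.Im a * complex.Im b by case: a b => [? ?] [? ?].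
have ImM (a b : K) : complex.Im (a * b) =
  complex.Re a * complex.Im b + complex.Im a * complex.Re b by case: a b => [? ?] [? ?].
have ReD (a b : K) : complex.Re (a + b) = complex.Re a + complex.Re b
  by case: a b => [? ?] [? ?].
have ImD (a b : K) : complex.Im (a + b) = complex.Im a + complex.Im b
  by case: a b => [? ?] [? ?].
move=> [d1 d2] [e1 e2]; split; rewrite ?ReD ?ImD ?ReM ?ImM.
  have -> : (fun t => complex.Re (u t * v t)) =
    (fun t => complex.Re (u t)) * (fun t => complex.Re (v t)) -
    (fun t => complex.Im (u t)) * (fun t => complex.Im (v t)).
    by apply/funext => t; rewrite ReM.
  by apply: is_derive_eq; rewrite /GRing.scale /=; ring.
have -> : (fun t => complex.Im (u t * v t)) =
  (fun t => complex.Re (u t)) * (fun t => complex.Im (v t)) +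
  (fun t => complex.Im (u t)) * (fun t => complex.Re (v t)).
  by apply/funext => t; rewrite ImM.
by apply: is_derive_eq; rewrite /GRing.scale /=; ring.
Qed.

Definition twopii : K := 0 +i* (2 * pi).

Lemma twopii_neq0 : twopii != 0.
Proof.
rewrite eq_complex /= eqxx /=; apply: lt0r_neq0.
by rewrite mulr_gt0 ?pi_gt0.
Qed.

Lemma cder_ce x : cder ce x (twopii * ce x).
Proof.
have cE t : cos (2 * pi * t) = harm 1 0 t by rewrite /harm /freq mulr1z mulr1 addr0.
have sE t : sin (2 * pi * t) = harm 1 (- (pi / 2)) t.
  by rewrite /harm /freq mulr1z mulr1 cosBpihalf.
split=> /=; rewrite !(mul0r, sub0r, add0r, addr0).
  under eq_fun do rewrite cE.
  have := is_derive_harm 1 0 x; rewrite {2}/harm add0r cosDpihalf /freq mulr1z !mulr1.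
  by rewrite mulrN.
under eq_fun do rewrite sE.
have := is_derive_harm 1 (- (pi / 2)) x; rewrite {2}/harm addNr addr0 /freq mulr1z
  !mulr1.
by [].
Qed.

Lemma cder_horner p x : cder (fun t => p.[ce t]) x (twopii * ('X * p^`()).[ce x]).
Proof.
elim/poly_ind: p => [|p c IHp].
  rewrite deriv0 mulr0 horner0 mulr0; under eq_fun do rewrite horner0.
  exact: cder_cst.
have := cderD (cderM IHp (cder_ce x)) (cder_cst c x).
under [X in cder X]eq_fun do rewrite -hornerMXaddC.
congr cder; rewrite derivD derivM derivX derivC !(hornerD, hornerM, hornerX,
  hornerC); ring.
Qed.

(* A trigonometric polynomial g of degree at most M is encoded by the polynomial
   p such that p.[ce x] = ce x ^+ M * g x. *)
Lemma deriv_trig_poly (g : R -> R) (g' : R) p M x :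
  (forall t, ce t ^+ M * (g t)%:C = p.[ce t]) -> is_derive x 1 g g' ->
  ce x ^+ M * g'%:C = twopii * (('X * p^`()).[ce x] - M%:R * p.[ce x]).
Proof.
move=> gp dg; have d1 := cder_horner p x.
have eM : cder (fun t => ce t ^+ M) x (twopii * (M%:R * ce x ^+ M)).
  have := cder_horner 'X^M x.
  under [X in cder X]eq_fun do rewrite hornerXn.
  congr cder; congr (_ * _); rewrite derivXn !hornerE hornerMn hornerXn.
  by case: M {gp} => [|M]; rewrite ?mulr0n ?mulr0 ?mul0r //= -mulr_natl exprS; ring.
have dgC : cder (fun t => (g t)%:C) x g'%:C.
  by split => //=; exact: is_derive_cst.
have := cderM eM dgC; under [X in cder X]eq_fun do rewrite gp.
move=> /(cder_unique d1) e.
rewrite mulrBr e -gp; ring.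
Qed.

(** Euler's formulas times z^M: (z^n + z^-n) / 2 is the cosine and i (z^n - z^-n) / 2 is minus the
    sine. The truncated M - n is the true exponent when n <= M. *)
Definition tpoly (M n : nat) (b : bool) : {poly K} :=
  if b then ('i / 2) *: ('X^(M + n) - 'X^(M - n))
  else 2^-1 *: ('X^(M + n) + 'X^(M - n)).

Lemma horner_tpoly M n b x : (n <= M)%N ->
  (tpoly M n b).[ce x] = ce x ^+ M * (harm n (phase R b) x)%:C.
Proof.
move=> nM; have cM : ce x ^+ M = ce x ^+ n * ce x ^+ (M - n) by rewrite -exprD subnKC.
have [c [s [An cs hc hs]]] : exists c s : R, [/\ ce x ^+ n =
  c +i* s, c ^+ 2 + s ^+ 2 = 1,
    harm n (phase R false) x = c & harm n (phase R true) x = - s].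
  exists (cos (2 * pi * (n%:R * x))), (sin (2 * pi * (n%:R * x))); split.
  - by rewrite ceX.
  - exact: cos2Dsin2.
  - by rewrite /harm /freq addr0; congr cos; ring.
  - by rewrite /harm /freq cosDpihalf; congr (- sin _); ring.
have two : (2 : K) != 0 by rewrite pnatr_eq0.
have hC : c%:C = 2^-1 * (c +i* s + (c -i* s)).
  apply: (mulfI two); rewrite mulrA divff // mul1r.
  by apply: eq_complexP => /=; rewrite ?mul0r; ring.
have sC : (- s)%:C = 'i / 2 * (c +i* s - (c -i* s)).
  rewrite mulrAC; apply: (mulfI two); rewrite mulrCA divff // mulr1.
  by apply: eq_complexP => /=; rewrite ?mul0r; ring.
have cc : (c +i* s) * (c -i* s) = 1.
  by apply: eq_complexP => /=; rewrite -?cs; ring.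
rewrite /tpoly; case: b; rewrite ?hs ?hc hornerZ !(hornerD, hornerN,
  hornerXn) exprD cM An.
  rewrite sC; rewrite -[X in _ - X]mul1r -cc; ring.
rewrite hC -[X in _ + X]mul1r -cc; ring.
Qed.

Lemma size_tpoly M n b : (n <= M)%N -> (size (tpoly M n b) <= (2 * M).+1)%N.
Proof.
move=> nM; have s1 : (size ('X^(M + n) : {poly K}) <= (2 * M).+1)%N.
  by rewrite size_polyXn ltnS mul2n -addnn leq_add2l.
have s2 : (size ('X^(M - n) : {poly K}) <= (2 * M).+1)%N.
  by rewrite size_polyXn ltnS mul2n -addnn (leq_trans (leq_subr _ _)) // leq_addr.
rewrite /tpoly; case: b; rewrite (leq_trans (size_scale_leq _ _)) //
  (leq_trans (size_polyD _ _)) // geq_max s1 ?size_polyN s2 //.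
Qed.

Variable M : nat.
Variable a : nat -> bool -> nat -> bool -> R.

Definition trig_bipoly : {poly {poly K}} :=
  \sum_(m < M.+1) \sum_(b : bool) \sum_(n < M.+1) \sum_(c : bool)
    ((a m b n c)%:C *: tpoly M m b)%:P * map_poly polyC (tpoly M n c).

Lemma horner_trig_bipoly x y : trig_bipoly.[(ce y)%:P].[ce x] =
  ce x ^+ M * ce y ^+ M * (\sum_(m < M.+1) \sum_(b : bool) \sum_(n < M.+1) \sum_(c :
    bool)
    a m b n c * harm n (phase R c) y * harm m (phase R b) x)%:C.
Proof.
rewrite /trig_bipoly !horner_sum rmorph_sum mulr_sumr; apply: eq_bigr => m _.
rewrite !horner_sum rmorph_sum mulr_sumr; apply: eq_bigr => b _.
rewrite !horner_sum rmorph_sum mulr_sumr; apply: eq_bigr => n _.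
rewrite !horner_sum rmorph_sum mulr_sumr; apply: eq_bigr => c _.
rewrite hornerM hornerC hornerM hornerZ horner_map /= hornerC !horner_tpoly -1?ltnS //.
by rewrite !rmorphM /=; ring.
Qed.

Lemma size_trig_bipoly : (size trig_bipoly <= (2 * M).+1)%N.
Proof.
rewrite /trig_bipoly.
do 4!(apply: (leq_trans (size_sum _ _ _)); apply/bigmax_leqP => ? _).
rewrite mul_polyC (leq_trans (size_scale_leq _ _)) // size_map_polyC.
by apply: size_tpoly; rewrite -ltnS.
Qed.

Lemma sizeY_trig_bipoly : (sizeY trig_bipoly <= (2 * M).+1)%N.
Proof.
rewrite sizeYE /trig_bipoly.
do 4!(rewrite rmorph_sum; apply: (leq_trans (size_sum _ _ _));
  apply/bigmax_leqP => ? _).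
rewrite rmorphM /= swapXY_map_polyC swapXY_polyC mulrC mul_polyC.
rewrite (leq_trans (size_scale_leq _ _)) // size_map_polyC (leq_trans (size_scale_leq
  _ _)) //.
by apply: size_tpoly; rewrite -ltnS.
Qed.

End Circle.

(** * Periodic lifts *)

Section Lift.
Local Open Scope quotient_scope.
Variable R : realType.
Local Notation V := 'rV[R]_2.
Implicit Types (L : V -> R) (v w l d : V) (x y : R).

Definition mk2 x y : V := \row_i (if i == ord0 then x else y).

Lemma mk2_0 x y : mk2 x y 0 ord0 = x.
Proof. by rewrite mxE. Qed.

Lemma mk2_1 x y : mk2 x y 0 ord_max = y.
Proof. by rewrite mxE. Qed.

Lemma ord2_cases (P : 'I_2 -> Prop) : P ord0 -> P ord_max -> forall i, P i.
Proof.
move=> P0 P1 [[|[|//]] i2]; first by rewrite (_ : Ordinal _ = ord0) //; apply: val_inj.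
by rewrite (_ : Ordinal _ = ord_max) //; apply: val_inj.
Qed.

Lemma row2P v w : v 0 ord0 = w 0 ord0 -> v 0 ord_max = w 0 ord_max -> v = w.
Proof. by move=> e0 e1; apply/rowP; apply: ord2_cases. Qed.

Lemma mk2E v : mk2 (v 0 ord0) (v 0 ord_max) = v.
Proof. by apply: row2P; rewrite ?mk2_0 ?mk2_1. Qed.

Lemma sum_ord2 (F : 'I_2 -> R) : \sum_(i < 2) F i = F ord0 + F ord_max.
Proof.
rewrite big_ord_recl big_ord_recl big_ord0 addr0; congr (_ + F _).
exact: val_inj.
Qed.

Lemma dotE v w : dot v w = v 0 ord0 * w 0 ord0 + v 0 ord_max * w 0 ord_max.
Proof. exact: sum_ord2. Qed.

Lemma mk2D x y x' y' : mk2 x y + mk2 x' y' = mk2 (x + x') (y + y').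
Proof. by apply: row2P; rewrite !mxE. Qed.

Lemma mk2Z c x y : c *: mk2 x y = mk2 (c * x) (c * y).
Proof. by apply: row2P; rewrite !mxE. Qed.

Lemma delta0E : delta_mx 0 ord0 = mk2 1 0.
Proof. by apply: row2P; rewrite !mxE. Qed.

Lemma delta1E : delta_mx 0 ord_max = mk2 0 1.
Proof. by apply: row2P; rewrite !mxE. Qed.

Lemma is_derive_line L (c : R -> V) v t :
  (forall h s, c (h + s) = h *: v + c s) -> derivable L (c t) v ->
  is_derive t 1 (fun s => L (c s)) ('D_v L (c t)).
Proof.
move=> cv dL.
have E : (fun h : R => h^-1 *: (((fun s => L (c s)) \o shift t) (h *: (1 :
  R)) - L (c t))) =
    (fun h : R => h^-1 *: ((L \o shift (c t)) (h *: v) - L (c t))).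
  by apply/funext => h /=; rewrite -cv /GRing.scale /= mulr1.
by apply: DeriveDef; rewrite /derivable /derive E.
Qed.

Lemma is_derive_mk2_0 L x y : (forall v, derivable L v (delta_mx 0 ord0)) ->
  is_derive x 1 (fun s => L (mk2 s y)) (pderiv ord0 L (mk2 x y)).
Proof.
move=> dL; apply: (is_derive_line (c := fun s => mk2 s y)) => // h s.
by rewrite delta0E mk2Z mk2D mulr1 mulr0 add0r.
Qed.

Lemma is_derive_mk2_1 L x y : (forall v, derivable L v (delta_mx 0 ord_max)) ->
  is_derive y 1 (fun s => L (mk2 x s)) (pderiv ord_max L (mk2 x y)).
Proof.
move=> dL; apply: (is_derive_line (c := fun s => mk2 x s)) => // h s.
by rewrite delta1E mk2Z mk2D mulr1 mulr0 add0r.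
Qed.

Lemma continuous_mk2_0 L y : continuous L -> continuous (fun s => L (mk2 s y)).
Proof.
move=> cL s; apply: (@continuous_comp _ _ _ (fun s => mk2 s y) L); last exact: cL.
have -> : (fun s => mk2 s y) = (fun s => s *: mk2 1 0 + mk2 0 y).
  by apply/funext => t; rewrite mk2Z mk2D mulr1 mulr0 add0r addr0.
by apply: cvgD; [exact: scalel_continuous|exact: cvg_cst].
Qed.

Lemma continuous_mk2_1 L x : continuous L -> continuous (fun s => L (mk2 x s)).
Proof.
move=> cL s; apply: (@continuous_comp _ _ _ (fun s => mk2 x s) L); last exact: cL.
have -> : (fun s => mk2 x s) = (fun s => s *: mk2 0 1 + mk2 x 0).
  by apply/funext => t; rewrite mk2Z mk2D mulr1 mulr0 add0r addr0.
by apply: cvgD; [exact: scalel_continuous|exact: cvg_cst].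
Qed.

Definition periodic2 L := forall v l, l \in @int_lattice R -> L (v + l) = L v.

Lemma int_latticeP l :
  reflect (exists a b : int, l = mk2 a%:~R b%:~R) (l \in @int_lattice R).
Proof.
apply: (iffP idP) => [|[a [b ->]]]; rewrite -topredE /=.
  move=> /mxOverP lZ.
  have /intrP[a aE] := lZ 0 ord0; have /intrP[b bE] := lZ 0 ord_max.
  by exists a, b; rewrite -aE -bE mk2E.
by apply/mxOverP => i j; rewrite mxE; case: ifP => _; exact: intr_int.
Qed.

Lemma periodic2_pderiv i L : periodic2 L -> periodic2 (pderiv i L).
Proof.
move=> pL v l lI; rewrite /pderiv /derive.
have -> // : (fun h : R => h^-1 *: ((L \o shift (v + l)) (h *: delta_mx 0 i) - L (v +
  l))) =
    (fun h : R => h^-1 *: ((L \o shift v) (h *: delta_mx 0 i) - L v)).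
by apply/funext => h /=; rewrite addrA !(pL _ _ lI).
Qed.

Lemma periodic2_bounded L : continuous L -> periodic2 L ->
  exists C, forall v, `|L v| <= C.
Proof.
move=> cL pL.
have cpt : compact [set v : V | forall i, `[0, 1]%classic (v ord0 i)].
  exact: (@rV_compact R 2 (fun=> `[0, 1]%classic) (fun=> @segment_compact R 0 1)).
have ne : [set v : V | forall i, `[0, 1]%classic (v ord0 i)] !=set0.
  by exists 0 => i /=; rewrite mxE in_itv /= lexx ler01.
have cN : {within [set v : V | forall i, `[0, 1]%classic (v ord0 i)],
    continuous (fun v => `|L v|)}.
  apply: continuous_subspaceT => v; apply: continuous_comp; first exact: cL.
  exact: norm_continuous.
have [c _ Hc] := EVT_max_rV ne cpt cN.
exists `|L c| => v.
pose l := - mk2 (Num.floor (v 0 ord0))%:~R (Num.floor (v 0 ord_max))%:~R.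
have lI : l \in @int_lattice R.
  apply/int_latticeP; exists (- Num.floor (v 0 ord0)), (- Num.floor (v 0 ord_max)).
  by rewrite /l; apply: row2P; rewrite !mxE /= mulrNz.
rewrite -(pL v l lI); apply: Hc; apply: mem_set => /=; apply: ord2_cases.
  rewrite !mxE /= in_itv /=; have /andP[] := floor_itv (v 0 ord0).
  by rewrite intrD mulr1z => *; apply/andP; split; lra.
rewrite !mxE /= in_itv /=; have /andP[] := floor_itv (v 0 ord_max).
by rewrite intrD mulr1z => *; apply/andP; split; lra.
Qed.

Lemma pi_eq v w : (\pi_(torus R) v = \pi_(torus R) w) <-> v - w \in @int_lattice R.
Proof. by rewrite Quotient.idealrBE; split => /eqP. Qed.

Variables (f : torus R -> R) (E : R).
Hypothesis hf : laplace_eigenfunction f E.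
Local Notation L := (lift_torus f).

Lemma periodic2_lift : periodic2 L.
Proof.
move=> v l lI; rewrite /lift_torus; congr f; apply/pi_eq.
by rewrite addrAC subrr add0r.
Qed.

Lemma repr_pi v : exists2 l, l \in @int_lattice R & repr (\pi_(torus R) v) = v + l.
Proof.
exists (repr (\pi_(torus R) v) - v); last by rewrite addrCA subrr addr0.
by apply/pi_eq; rewrite reprK.
Qed.

Lemma lift_laplacian v :
  pderiv ord0 (pderiv ord0 L) v + pderiv ord_max (pderiv ord_max L) v = - E * L v.
Proof.
have [_ _ /(_ (\pi_(torus R) v))] := hf.
rewrite /laplacian sum_ord2; have [l lI ->] := repr_pi v.
rewrite !(periodic2_pderiv _ (periodic2_pderiv _ periodic2_lift)) //.
by rewrite /lift_torus mulNr => <-; rewrite opprK.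
Qed.

Definition phi x y := L (mk2 x y).
Definition phix x y := pderiv ord0 L (mk2 x y).
Definition phiy x y := pderiv ord_max L (mk2 x y).

Lemma phi_expansion (M : nat) :
  (forall m : nat, (M < m)%N -> E < freq R m ^+ 2) ->
  exists a : nat -> bool -> nat -> bool -> R,
  forall x y, phi x y = \sum_(m < M.+1) \sum_(b : bool) \sum_(n < M.+1) \sum_(c : bool)
    a m b n c * harm n (phase R c) y * harm m (phase R b) x.
Proof.
move=> hM; have [[c1 c2] _ _] := hf.
have pL := periodic2_lift.
have [d0 cd0] := c1 ord0; have [d1 cd1] := c1 ord_max.
have [d00 cd00] := c2 ord0 ord0; have [d11 cd11] := c2 ord_max ord_max.
have e10 : mk2 1 0 \in @int_lattice R.
  by apply/int_latticeP; exists 1, 0.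
have e01 : mk2 0 1 \in @int_lattice R.
  by apply/int_latticeP; exists 0, 1.
have bd G : continuous G -> periodic2 G -> bounded2 (fun x y => G (mk2 x y)).
  by move=> cG pG; have [C HC] := periodic2_bounded cG pG; exists C => x y; exact: HC.
have bd' G : continuous G -> periodic2 G -> bounded2 (fun y x => G (mk2 x y)).
  by move=> cG pG; have [C HC] := periodic2_bounded cG pG; exists C => x y; exact: HC.
apply: (@eigen_expansion R E phi phix phiy
  (fun x y => pderiv ord0 (pderiv ord0 L) (mk2 x y))
  (fun x y => pderiv ord_max (pderiv ord_max L) (mk2 x y)) M _ _ _ hM).
- split.
  + by move=> x y; apply: (@is_derive_mk2_0 L x y d0).
  + by move=> x y; apply: (@is_derive_mk2_0 (pderiv ord0 L) x y d00).
  + by move=> y x; rewrite /phi -(pL (mk2 x y) _ e10) mk2D addr0.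
  + exact: (bd (pderiv ord0 L) cd0 (periodic2_pderiv ord0 pL)).
  + exact: (bd (pderiv ord0 (pderiv ord0 L)) cd00 (periodic2_pderiv ord0
    (periodic2_pderiv ord0 pL))).
  + by move=> y; apply: (@continuous_mk2_0 (pderiv ord0 (pderiv ord0 L)) y).
  + by move=> y; apply: (@continuous_mk2_1 (pderiv ord0 L) y).
  + by move=> y; apply: (@continuous_mk2_1 (pderiv ord0 (pderiv ord0 L)) y).
- split.
  + by move=> y x; apply: (@is_derive_mk2_1 L x y d1).
  + by move=> y x; apply: (@is_derive_mk2_1 (pderiv ord_max L) x y d11).
  + by move=> x y; rewrite /phi -(pL (mk2 x y) _ e01) mk2D addr0.
  + exact: (bd' (pderiv ord_max L) cd1 (periodic2_pderiv ord_max pL)).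
  + exact: (bd' (pderiv ord_max (pderiv ord_max L)) cd11 (periodic2_pderiv ord_max
    (periodic2_pderiv ord_max pL))).
  + by move=> x; apply: (@continuous_mk2_1 (pderiv ord_max (pderiv ord_max L)) x).
  + by move=> y; apply: (@continuous_mk2_0 (pderiv ord_max L) y).
  + by move=> y; apply: (@continuous_mk2_0 (pderiv ord_max (pderiv ord_max L)) y).
- by move=> x y; exact: lift_laplacian.
Qed.

End Lift.

(** * Nonsingular points *)

(** An infinite set would contain a finite one with more than r elements, so a bound on
    duplicate-free lists also yields finiteness. *)
Lemma counting_le (T : choiceType) (R : realType) (A : set T) (r : R) :
  (forall s : seq T, uniq s -> (forall x, x \in s -> A x) -> (size s)%:R <= r) ->
  (counting A <= r%:E)%E.
Proof.
move=> H; have fA : finite_set A.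
  apply: contrapT => /(@infinite_set_fset _ _ (Num.truncn r).+1)[B BA sB].
  have := H (enum_fset B) (fset_uniq B) (fun x xB => BA x xB).
  move=> /le_lt_trans/(_ (truncnS_gt r)); rewrite ltr_nat ltnNge.
  by rewrite sB.
rewrite /counting asboolT // lee_fin; apply: H; first exact: fset_uniq.
by move=> x; rewrite in_fset_set //; exact: set_mem.
Qed.

Section Points.
Local Open Scope complex_scope.
Local Open Scope quotient_scope.
Variables (R : realType) (f : torus R -> R) (E : R) (w : 'rV[R]_2).
Hypothesis hE : 0 < E.
Hypothesis hf : laplace_eigenfunction f E.
Local Notation K := R[i].
Local Notation L := (lift_torus f).
Local Notation pi2 := (\pi_(torus R)).
Implicit Types (v : 'rV[R]_2) (x y t : R).

Definition maxfreq : nat := Num.truncn (Num.sqrt E / (2 * pi)).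
Local Notation M := maxfreq.

Lemma maxfreq_le : M%:R <= Num.sqrt E / (2 * pi).
Proof. by rewrite truncn_le divr_ge0 ?sqrtr_ge0 // mulr_ge0 // pi_ge0. Qed.

Lemma maxfreq_lt (m : nat) : (M < m)%N -> E < freq R m ^+ 2.
Proof.
move=> Mm; have p0 : 0 < 2 * pi :> R by rewrite mulr_gt0 ?pi_gt0.
have sm : Num.sqrt E < 2 * pi * m%:R.
  rewrite mulrC -ltr_pdivrMr //; apply: lt_le_trans (truncnS_gt _) _.
  by rewrite ler_nat.
rewrite -[X in X < _]sqr_sqrtr ?ltW // ltr_sqr ?nnegrE ?sqrtr_ge0 //.
by rewrite /freq mulr_ge0 // ltW.
Qed.

Definition spectral_poly (F : {poly {poly K}}) :=
  [/\ (size F <= (2 * M).+1)%N, (sizeY F <= (2 * M).+1)%N, F != 0 &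
   forall x y, F.[(ce y)%:P].[ce x] = ce x ^+ M * ce y ^+ M * (phi f x y)%:C].

Lemma lift_pi v : f (pi2 v) = phi f (v 0 ord0) (v 0 ord_max).
Proof. by rewrite /phi mk2E. Qed.

Lemma lift_repr (x : torus R) : f x = phi f (repr x 0 ord0) (repr x 0 ord_max).
Proof. by rewrite -lift_pi reprK. Qed.

Lemma spectral_poly_exists : exists F, spectral_poly F.
Proof.
have [a aE] := phi_expansion hf maxfreq_lt.
have FE x y : (trig_bipoly M a).[(ce y)%:P].[ce x] =
  ce x ^+ M * ce y ^+ M * (phi f x y)%:C.
  by rewrite horner_trig_bipoly aE.
exists (trig_bipoly M a); split => //; first exact: size_trig_bipoly.
  exact: sizeY_trig_bipoly.
have [_ [x0 fx0] _] := hf.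
apply/eqP => F0; move: fx0; rewrite lift_repr.
have := FE (repr x0 0 ord0) (repr x0 0 ord_max); rewrite F0 !horner0 => /esym/eqP.
rewrite !mulf_eq0 !expf_eq0 !(negPf (ce_neq0 _)) !andbF /=.
by rewrite eq_complex /= => /andP[-> _].
Qed.

Variable F : {poly {poly K}}.
Hypothesis hF : spectral_poly F.

Lemma spectral_zero x y : (F.[(ce y)%:P].[ce x] = 0) <-> phi f x y = 0.
Proof.
have [_ _ _ ->] := hF; split => [/eqP|->]; last by rewrite mulr0.
rewrite !mulf_eq0 !expf_eq0 !(negPf (ce_neq0 _)) !andbF /=.
by rewrite eq_complex /= => /andP[/eqP-> _].
Qed.

Lemma horner_deriv_inner (p : {poly {poly K}}) (c : K) :
  (p.[c%:P])^`() = (deriv_inner p).[c%:P].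
Proof. by rewrite /deriv_inner horner_swapXY -deriv_map -horner_polyC. Qed.

(** At a zero of f, differentiating the factor z^M contributes nothing, so the derivatives of f and
    of F agree up to nonvanishing factors. *)
Lemma spectral_dx x y : phi f x y = 0 ->
  ce x ^+ M * ce y ^+ M * (phix f x y)%:C =
  twopii R * (ce x * (deriv_inner F).[(ce y)%:P].[ce x]).
Proof.
move=> p0; have [[c1 _] _ _] := hf; have [_ _ _ FE] := hF.
have cy : ce y ^+ M != 0 by rewrite expf_neq0 ?ce_neq0.
have gp t : ce t ^+ M * (phi f t y)%:C = ((ce y ^+ M)^-1 *: F.[(ce y)%:P]).[ce t].
  by rewrite hornerZ FE [X in _ = _ * (X * _)]mulrC -mulrA mulKf.
have := deriv_trig_poly gp (is_derive_mk2_0 x y (c1 ord0).1).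
rewrite -/(phix f x y) -gp p0 !mulr0 subr0 derivZ hornerM hornerX hornerZ.
rewrite horner_deriv_inner => e.
by rewrite mulrAC e -!mulrA; congr (_ * (_ * _)); rewrite [X in _ * X]mulrC mulKf.
Qed.

Lemma spectral_dy x y : phi f x y = 0 ->
  ce x ^+ M * ce y ^+ M * (phiy f x y)%:C =
  twopii R * (ce y * F^`().[(ce y)%:P].[ce x]).
Proof.
move=> p0; have [[c1 _] _ _] := hf; have [_ _ _ FE] := hF.
have cx : ce x ^+ M != 0 by rewrite expf_neq0 ?ce_neq0.
have gp t : ce t ^+ M * (phi f x t)%:C = ((ce x ^+ M)^-1 *: eval_inner (ce x) F).[ce t].
  by rewrite hornerZ horner_eval_inner FE -!mulrA mulKf.
have := deriv_trig_poly gp (is_derive_mk2_1 x y (c1 ord_max).1).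
rewrite -/(phiy f x y) -gp p0 !mulr0 subr0 derivZ hornerM hornerX hornerZ.
rewrite /eval_inner deriv_map -/(eval_inner (ce x) F^`()) horner_eval_inner => e.
by rewrite -mulrA e [LHS]mulrCA; congr (_ * _); rewrite mulrCA mulVKf.
Qed.

Local Notation al := ((w 0 ord0)%:C : K).
Local Notation be := ((w 0 ord_max)%:C : K).

Lemma spectral_dir x y : phi f x y = 0 ->
  ce x ^+ M * ce y ^+ M * (w 0 ord0 * phix f x y + w 0 ord_max * phiy f x y)%:C =
  twopii R * (dirD al be F).[(ce y)%:P].[ce x].
Proof.
move=> p0; rewrite /dirD !hornerE /=.
rewrite rmorphD !rmorphM /= mulrDr mulrCA spectral_dx // [X in _ + X]mulrCA
  spectral_dy //.
ring.
Qed.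

Lemma A_setP v : A_set w f (pi2 v) <-> phi f (v 0 ord0) (v 0 ord_max) = 0 /\
  w 0 ord0 * phix f (v 0 ord0) (v 0 ord_max) +
  w 0 ord_max * phiy f (v 0 ord0) (v 0 ord_max) = 0.
Proof.
rewrite /A_set /= lift_pi dotE /grad !mxE; have [l lI ->] := repr_pi v.
have pL := @periodic2_lift R f.
rewrite !(periodic2_pderiv _ pL v lI) /phix /phiy mk2E.
by rewrite [_ * w 0 ord0]mulrC [_ * w 0 ord_max]mulrC.
Qed.

(* Points on a component p of the spectral curve whose exponents all lie on a
   line orthogonal to w; such a component is invariant under translation in
   the direction w. *)
Definition on_line_component (x : torus R) := exists p q c,
  [/\ F = p * q, p.[(ce (repr x 0 ord_max))%:P].[ce (repr x 0 ord0)] = 0 &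
      forall j i, p`_j`_i != 0 -> al * i%:R + be * j%:R = c].

Lemma horner2_sum (p : {poly {poly K}}) (y z : K) : p.[y%:P].[z] =
  \sum_(j < size p) \sum_(i < size p`_j) p`_j`_i * z ^+ i * y ^+ j.
Proof.
rewrite (horner_coef p) horner_sum; apply: eq_bigr => j _.
by rewrite hornerM -polyC_exp hornerC horner_coef mulr_suml.
Qed.

(** Translation by t w multiplies the monomial z^i w^j by exp (2 pi i t (al i + be j)), the same
    phase for every monomial of p. *)
Lemma line_component_shift (p : {poly {poly K}}) c x y t :
  (forall j i, p`_j`_i != 0 -> al * i%:R + be * j%:R = c) ->
  p.[(ce y)%:P].[ce x] = 0 ->
  p.[(ce (y + t * w 0 ord_max))%:P].[ce (x + t * w 0 ord0)] = 0.
Proof.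
move=> pc p0; rewrite horner2_sum.
transitivity (ce (t * complex.Re c) * p.[(ce y)%:P].[ce x]); last by rewrite p0 mulr0.
rewrite horner2_sum mulr_sumr; apply: eq_bigr => j _.
rewrite mulr_sumr; apply: eq_bigr => i _.
have [->|pji] := eqVneq p`_j`_i 0; first by rewrite !mul0r mulr0.
have cE : complex.Re c = w 0 ord0 * i%:R + w 0 ord_max * j%:R.
  by rewrite -(pc _ _ pji) -!(rmorph_nat (real_complex R)) -!rmorphM -rmorphD.
rewrite cE !ceX.
have -> : ce (i%:R * (x + t * w 0 ord0)) = ce (i%:R * x) * ce (t * (w 0 ord0 * i%:R)).
  by rewrite -ceD; congr ce; ring.
have -> : ce (j%:R * (y + t * w 0 ord_max)) =
  ce (j%:R * y) * ce (t * (w 0 ord_max * j%:R)).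
  by rewrite -ceD; congr ce; ring.
by rewrite mulrDr ceD; ring.
Qed.

Lemma dirD_line_component (p : {poly {poly K}}) c :
  (forall j i, p`_j`_i != 0 -> al * i%:R + be * j%:R = c) ->
  dirD al be p = p * c%:P%:P.
Proof.
move=> pc; apply/polyP => j; apply/polyP => i.
rewrite coef_dirD !coefMC; have [->|pji] := eqVneq p`_j`_i 0;
  first by rewrite mulr0 mul0r.
by rewrite (pc _ _ pji) mulrC.
Qed.

(** Along the line p vanishes, and so does D p = c p; hence F and D F vanish there, which gives both
    conditions of [A_set]. *)
Lemma line_component_geodesic (x : torus R) : on_line_component x ->
  geodesic (repr x) w `<=` A_set w f.
Proof.
move=> [p [q [c [FE p0 pc]]]] _ [t _ <-]; apply/A_setP.
have pt := line_component_shift t pc p0.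
rewrite !mxE; set X := repr x 0 ord0 + _; set Y := repr x 0 ord_max + _.
rewrite -/X -/Y in pt.
have phi0 : phi f X Y = 0 by apply/spectral_zero; rewrite FE !hornerM pt mul0r.
split => //; have := spectral_dir phi0.
rewrite FE dirDM (dirD_line_component pc) !hornerD !hornerM pt !mul0r addr0 mulr0.
move/eqP; rewrite !mulf_eq0 !expf_eq0 !(negPf (ce_neq0 _)) !andbF /=.
by rewrite eq_complex /= => /andP[/eqP-> _].
Qed.

(** A nonzero monomial has no zero on the torus |z| = |w| = 1, so p has two distinct exponents, and
    their difference is orthogonal to the direction. *)
Lemma line_component_rational (x : torus R) : on_line_component x ->
  exists k : 'rV[int]_2, k != 0 /\ dot (int_vec R k) w = 0.
Proof.
move=> [p [q [c [FE p0 pc]]]]; have [_ _ F0 _] := hF.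
have pn0 : p != 0 by apply: contraNneq F0 => p00; rewrite FE p00 mul0r.
pose j0 := (size p).-1; pose i0 := (size p`_j0).-1.
have pj0 : p`_j0 != 0 by rewrite -lead_coefE lead_coef_eq0.
have pji0 : p`_j0`_i0 != 0 by rewrite -lead_coefE lead_coef_eq0.
have [[j [i [pji ne]]]|none] := pselect (exists j i, p`_j`_i != 0 /\ (j, i) <> (j0,
  i0)).
  exists (\row_l (if l == ord0 then i%:Z - i0%:Z else j%:Z - j0%:Z)); split.
    apply/eqP => /rowP k0; apply: ne.
    have := k0 ord0; have := k0 ord_max; rewrite !mxE /= => /eqP + /eqP.
    by rewrite !subr_eq0 !eqz_nat => /eqP-> /eqP->.
  have := pc _ _ pji; rewrite -(pc _ _ pji0) => e.
  have {}e : w 0 ord0 * i%:R + w 0 ord_max * j%:R =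
    w 0 ord0 * i0%:R + w 0 ord_max * j0%:R.
    apply: (@complexI R); rewrite !rmorphD !rmorphM !rmorph_nat; exact: e.
  by rewrite dotE !mxE /= !rmorphB /= !pmulrn in e *; lra.
exfalso; move: p0; rewrite horner2_sum.
have sj0 : (j0 < size p)%N by rewrite /j0 prednK // size_poly_gt0.
have si0 : (i0 < size (p`_j0)%R)%N by rewrite /i0 prednK // size_poly_gt0.
have zero j i : (j, i) <> (j0, i0) -> p`_j`_i = 0.
  by move=> ne; apply/eqP/negPn/negP => pji; apply: none; exists j, i.
rewrite (bigD1 (Ordinal sj0)) //= [X in _ + X]big1 ?addr0; last first.
  move=> j jj; rewrite big1 // => i _; rewrite zero ?mul0r // => -[e _].
  by move/eqP: jj; apply; apply: val_inj.
rewrite (bigD1 (Ordinal si0)) //= big1 ?addr0; last first.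
  move=> i ii; rewrite zero ?mul0r // => -[e].
  by move/eqP: ii; apply; apply: val_inj.
move/eqP; rewrite !mulf_eq0 !expf_eq0 !(negPf (ce_neq0 _)) !andbF !orbF.
exact/negP.
Qed.

Lemma card_good_points (s : seq (torus R)) : uniq s ->
  (forall x : torus R, x \in s -> [/\ A_set w f x,
    grad f x <> 0 & ~ on_line_component x]) ->
  (size s)%:R <= 2 / pi ^+ 2 * E.
Proof.
move=> us sP; have [sF sYF F0 _] := hF.
pose pt (x : torus R) : K * K := (ce (repr x 0 ord_max), ce (repr x 0 ord0)).
have ptI : injective pt.
  move=> x y e; have [k1 e1] := ce_inj (congr1 fst e).
  have [k0 e0] := ce_inj (congr1 snd e); rewrite -[x]reprK -[y]reprK.
  apply/pi_eq/int_latticeP; exists k0, k1; apply: row2P; rewrite !mxE /=.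
    by rewrite e0 addrAC subrr add0r.
  by rewrite e1 addrAC subrr add0r.
have card : (size s <= 2 * (2 * M) ^ 2)%N.
  rewrite -(size_map pt); apply: (@card_dirD_zeros _ al be F) => //.
    by rewrite map_inj_uniq.
  move=> _ /mapP[x xs ->] /=; have [Ax gx nx] := sP x xs.
  move: (Ax); rewrite -[x]reprK => /A_setP[phi0 dir0].
  rewrite reprK in phi0 dir0 *.
  split => //.
  - exact/spectral_zero.
  - apply: (mulfI (twopii_neq0 R)).
    by rewrite -spectral_dir // dir0 !mulr0.
  - have [/eqP i0|] := boolP ((deriv_inner F).[(ce (repr x 0 ord_max))%:P].[ce (repr
    x 0 ord0)] == 0); last by left.
    have [/eqP o0|] := boolP (F^`().[(ce (repr x 0 ord_max))%:P].[ce (repr x 0 ord0)]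
      == 0); last by right.
    exfalso; apply: gx; have := spectral_dx phi0; have := spectral_dy phi0.
    rewrite i0 o0 !mulr0 => /eqP + /eqP.
    rewrite !mulf_eq0 !expf_eq0 !(negPf (ce_neq0 _)) !andbF /= !eq_complex /=.
    rewrite /phix /phiy !mk2E => /andP[/eqP d1 _] /andP[/eqP d0 _].
    by apply: row2P; rewrite !mxE.
have p0 : 0 < pi :> R := pi_gt0 R.
apply: le_trans (_ : (2 * (2 * M) ^ 2)%:R <= _); first by rewrite ler_nat.
(* Since 2 M <= sqrt E / pi, the Bezout bound 2 (2 M)^2 is at most 2 E / pi^2. *)
have M2 : (2 * M%:R) ^+ 2 <= (Num.sqrt E / pi) ^+ 2 :> R.
  have := maxfreq_le; rewrite ler_sqr ?nnegrE ?mulr_ge0 ?divr_ge0 ?sqrtr_ge0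
    ?invr_ge0 ?pi_ge0 //.
  by rewrite invfM mulrCA -ler_pdivlMl // mulrC => h;
    rewrite mulrC -ler_pdivlMr // mulrC mulrC.
rewrite natrM natrX natrM; apply: le_trans (ler_wpM2l _ M2) _ => //.
have -> : (Num.sqrt E / pi) ^+ 2 = E / pi ^+ 2 by rewrite expr_div_n sqr_sqrtr // ltW.
by rewrite mulrA mulrAC.
Qed.

End Points.

(** * Closed geodesics *)

Section Directions.
Local Open Scope quotient_scope.
Variable R : realType.
Local Notation V := 'rV[R]_2.
Local Notation pi2 := (\pi_(torus R)).
Implicit Types (u v w : V) (k : 'rV[int]_2).

Lemma dot_ge0 u : 0 <= dot u u.
Proof. by rewrite dotE -!expr2 addr_ge0 ?sqr_ge0. Qed.

Lemma direction_dot u : direction u -> dot u u = 1.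
Proof. by move=> du; rewrite -[LHS]sqr_sqrtr ?dot_ge0 // [Num.sqrt _]du expr1n. Qed.

Lemma dot_eq0 u : (dot u u == 0) = (u == 0).
Proof.
apply/eqP/eqP => [|->]; last by rewrite dotE !mxE !mul0r addr0.
rewrite dotE -!expr2 => /eqP; rewrite paddr_eq0 ?sqr_ge0 // !sqrf_eq0.
by move=> /andP[/eqP u0 /eqP u1]; apply: row2P; rewrite mxE.
Qed.

Lemma dotC u v : dot u v = dot v u.
Proof. by rewrite !dotE; ring. Qed.

Lemma orthogonal_parallel u v w : w != 0 -> dot u w = 0 -> dot v w = 0 ->
  v != 0 -> exists c, u = c *: v.
Proof.
rewrite -!dot_eq0 !dotE; set a := w 0 ord0; set b := w 0 ord_max.
set u0 := u 0 ord0; set u1 := u 0 ord_max; set v0 := v 0 ord0; set v1 := v 0 ord_max.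
move=> ww uw vw vv; have det : u0 * v1 = u1 * v0.
  (* Times |w|^2, the determinant of u and v is a combination of the two vanishing scalar
     products. *)
  apply/eqP; rewrite -subr_eq0 -(mulIr_eq0 _ (mulIf ww)); apply/eqP.
  transitivity (v1 * a * (u0 * a + u1 * b) - u1 * a * (v0 * a + v1 * b)
    + u0 * b * (v0 * a + v1 * b) - v0 * b * (u0 * a + u1 * b)); first by ring.
  by rewrite uw vw !mulr0 !subr0 addr0.
exists ((u0 * v0 + u1 * v1) / (v0 * v0 + v1 * v1)); apply: row2P;
  rewrite mxE -/v0 -/v1 -/u0 -/u1;
  apply: (mulIf vv); rewrite mulrAC divfK //.
  by rewrite mulrDr mulrDl -[u1 * v1 * v0]mulrAC -det; ring.
by rewrite mulrDr mulrDl mulrA -det; ring.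
Qed.

Lemma int_vec0 k : (int_vec R k == 0) = (k == 0).
Proof.
apply/eqP/eqP => [e|->]; apply/rowP => i; rewrite !mxE //.
by have /rowP/(_ i) := e; rewrite !mxE => /eqP; rewrite intr_eq0 => /eqP.
Qed.

Lemma primitive_multiple k : k != 0 -> exists (g : int) k',
  primitive_vec k' /\ int_vec R k = g%:~R *: int_vec R k'.
Proof.
move=> k0; pose g := gcdz (k 0 ord0) (k 0 ord_max).
have g0 : g != 0.
  rewrite /g gcdz_eq0; apply: contra k0 => /andP[/eqP k00 /eqP k01].
  by apply/eqP/rowP; apply: ord2_cases; rewrite mxE.
have d0 := divzK (dvdz_gcdl (k 0 ord0) (k 0 ord_max)).
have d1 := divzK (dvdz_gcdr (k 0 ord0) (k 0 ord_max)).
exists g, (\row_i divz (k 0 i) g); split; last first.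
  by apply: row2P; rewrite !mxE -intrM mulrC ?d0 ?d1.
have [a [b ab]] := Bezoutz (k 0 ord0) (k 0 ord_max).
apply/coprimezP; exists (a, b); rewrite !mxE /=; apply: (mulIf g0).
by rewrite mul1r mulrDl -!mulrA d0 d1.
Qed.

(** The vector is the one behind the value picked by [xget]. The set is inhabited: an integer vector
    along zeta, divided by its gcd and normalized, is zeta up to sign. *)
Lemma height_spec (zeta : V) : rational_direction zeta -> exists k (c : R),
  [/\ primitive_vec k, zeta = c *: int_vec R k &
      height zeta = maxn (absz (k 0 ord0)) (absz (k 0 ord_max))].
Proof.
move=> [/direction_dot dz [c [k' zE]]].
have k'0 : k' != 0.
  apply/eqP => k'0; move: dz; rewrite zE dotE !mxE k'0 !mxE !mulr0 addr0 => /esym/eqP.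
  by rewrite oner_eq0.
have [g [k [pk kE]]] := primitive_multiple k'0.
pose e := enorm (int_vec R k); pose d := c * g%:~R.
have zd : zeta = d *: int_vec R k by rewrite zE kE scalerA.
have e2 : d ^+ 2 * e ^+ 2 = 1.
  rewrite -dz zd /e sqr_sqrtr ?dot_ge0 // !dotE !mxE; ring.
have e0 : e != 0.
  by apply: contra_eq_neq e2 => ->; rewrite expr0n mulr0 eq_sym oner_eq0.
have dE : d = e^-1 \/ d = - e^-1.
  have : (d * e) ^+ 2 == 1 by rewrite exprMn e2.
  rewrite sqrf_eq1 => /orP[] /eqP h; [left|right]; apply: (mulIf e0);
    by rewrite h ?mulNr mulVf.
have ex : exists h : nat, [set h | exists k0 : 'rV[int]_2,
    [/\ primitive_vec k0, zeta = (enorm (int_vec R k0))^-1 *: int_vec R k0 \/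
      zeta = - ((enorm (int_vec R k0))^-1 *: int_vec R k0) &
      h = maxn (absz (k0 0 ord0)) (absz (k0 0 ord_max))]] h.
  exists (maxn (absz (k 0 ord0)) (absz (k 0 ord_max))), k; split => //.
  by case: dE => dE; rewrite zd dE; [left|right]; rewrite ?scaleNr.
have [k1 [pk1 zk1 hk1]] := xgetPex 0%N ex.
case: zk1 => zk1; [exists k1, (enorm (int_vec R k1))^-1|exists k1,
  (- (enorm (int_vec R k1))^-1)];
  by split; rewrite ?scaleNr.
Qed.

Lemma primitive_neq0 k : primitive_vec k -> k != 0.
Proof.
move=> pk; apply/eqP => k0; move: pk.
by rewrite /primitive_vec k0 !mxE.
Qed.

(** A quarter turn of an integer vector along zeta is an integer vector along w. *)
Lemma rational_perp (zeta w : V) : direction w -> dot w zeta = 0 ->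
  rational_direction zeta -> rational_direction w.
Proof.
move=> dw wz [dz [c [k zE]]]; split => //.
have zz := direction_dot dz.
pose k' : 'rV[int]_2 := \row_i (if i == ord0 then - k 0 ord_max else k 0 ord0).
have z0 : zeta != 0 by rewrite -dot_eq0 zz oner_eq0.
have k0 : k != 0.
  apply: contraNneq z0 => k0; rewrite zE k0; apply/eqP; apply: row2P;
    rewrite !mxE mulr0 //.
have k'0 : k' != 0.
  apply: contraNneq k0 => k'0; apply/eqP/rowP; apply: ord2_cases; rewrite mxE.
    by have /rowP/(_ ord_max) := k'0; rewrite !mxE.
  by have /rowP/(_ ord0) := k'0; rewrite !mxE /= => /eqP; rewrite oppr_eq0 => /eqP.
have kz : dot (int_vec R k') zeta = 0.
  by rewrite zE !dotE !mxE /= rmorphN /=; ring.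
have kk : int_vec R k' != 0 by rewrite int_vec0.
by have [d wE] := orthogonal_parallel z0 wz kz kk; exists d, k'.
Qed.

Variable w : V.
Hypothesis dw : direction w.
Variable k : 'rV[int]_2.
Hypothesis pk : primitive_vec k.
Hypothesis kw : dot (int_vec R k) w = 0.

(** Geodesics in direction w are the level sets of <k, .> modulo 1: as k is primitive, a Bezout
    relation gives a lattice vector l with <k, l> = n, and u - v - l, orthogonal to k, is a multiple
    of w. *)
Lemma geodesic_mem u v (n : int) : dot (int_vec R k) (u - v) = n%:~R ->
  geodesic v w (pi2 u).
Proof.
move=> e; have /coprimezP[[a b] /= ab] := pk.
pose l : V := mk2 (n * a)%:~R (n * b)%:~R.
have kl : dot (int_vec R k) l = n%:~R.
  rewrite dotE !mxE /= -!intrM -intrD; congr (_%:~R).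
  by rewrite -[RHS]mulr1 -ab; ring.
have kn0 : int_vec R k != 0 by rewrite int_vec0 primitive_neq0.
have wn0 : w != 0 by rewrite -dot_eq0 (direction_dot dw) oner_eq0.
have ul : dot (u - v - l) (int_vec R k) = 0.
  rewrite dotC; have -> : dot (int_vec R k) (u - v - l) =
    dot (int_vec R k) (u - v) - dot (int_vec R k) l by rewrite !dotE !mxE; ring.
  by rewrite e kl subrr.
have [t tE] := orthogonal_parallel kn0 ul (etrans (dotC _ _) kw) wn0.
exists t => //=; apply/pi_eq; rewrite -tE.
have -> : v + (u - v - l) - u = - l by apply: row2P; rewrite !mxE; ring.
apply/int_latticeP; exists (- (n * a)), (- (n * b)).
by apply: row2P; rewrite !mxE /= mulrNz.
Qed.

Lemma geodesic_eq v v' x : geodesic v w x -> geodesic v' w x ->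
  geodesic v w = geodesic v' w.
Proof.
move=> [t _ <-] [t' _ /pi_eq e].
have key a a' : (v' + a' *: w - (v + a *: w)) \in @int_lattice R ->
    forall s, pi2 (v + s *: w) = pi2 (v' + (a' - a + s) *: w).
  move=> h s; apply/esym/pi_eq; move: h.
  rewrite (_ : v' + a' *: w - (v + a *: w) = v' + (a' - a + s) *: w - (v + s *: w)) //.
  by apply: row2P; rewrite !mxE; ring.
apply/seteqP; split => y [s _ <-].
  by rewrite (key _ _ e); exists (t' - t + s).
exists (s - t' + t) => //; rewrite (key _ _ e); congr (pi2 (_ + _ *: _)); ring.
Qed.

End Directions.

(** * Number of geodesics contained in [A_set] *)

Section NodalGeodesics.
Local Open Scope quotient_scope.
Variables (R : realType) (f : torus R -> R) (E : R) (w : 'rV[R]_2).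
Hypothesis hE : 0 < E.
Hypothesis hf : laplace_eigenfunction f E.
Hypothesis dw : direction w.
Local Notation K := R[i]%C.
Local Notation V := 'rV[R]_2.
Local Notation M := (maxfreq E).
Local Notation pi2 := (\pi_(torus R)).

Definition nodal_geodesics : set (set (torus R)) :=
  [set G | exists v, G = geodesic v w /\ G `<=` A_set w f].

Variables (k : 'rV[int]_2).
Hypothesis pk : primitive_vec k.
Hypothesis kw : dot (int_vec R k) w = 0.

(* Each geodesic meets the closed curve pt in |ki| points, all of which are
   zeros of q, the restriction of the spectral polynomial to the curve. *)
Lemma card_geodesics_on_curve (pt : R -> V) (ki : int) (c0 : R) (q : {poly K})
    (s : seq (set (torus R))) :
  (forall x, dot (int_vec R k) (pt x) = ki%:~R * x + c0) ->
  (forall x x', ce x = ce x' -> pi2 (pt x) = pi2 (pt x')) ->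
  (forall x, f (pi2 (pt x)) = 0 -> q.[ce x] = 0) ->
  q != 0 -> (size q <= (2 * M).+1)%N -> ki != 0 ->
  uniq s -> (forall G, G \in s -> nodal_geodesics G) ->
  (size s * absz ki <= 2 * M)%N.
Proof.
move=> kpt ptper qz q0 sq ki0 us sG.
have kiR : ki%:~R != 0 :> R by rewrite intr_eq0.
have /choice[vG vGP] : forall G, exists v, G \in s -> G =
  geodesic v w /\ G `<=` A_set w f.
  move=> G; have [/sG[v Gv]|] := boolP (G \in s); first by exists v.
  by exists 0.
(* Solution of <k, pt x> = <k, v> + n with v on G; the values n < |ki| give the |ki| crossings. *)
pose X G (n : nat) : R := (dot (int_vec R k) (vG G) + n%:R - c0) / ki%:~R.
have onG G n : G \in s -> G (pi2 (pt (X G n))).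
  move=> Gs; have [e _] := vGP G Gs; rewrite {1}e.
  apply: (geodesic_mem dw pk kw (n := n)).
  have -> : dot (int_vec R k) (pt (X G n) - vG G) =
    dot (int_vec R k) (pt (X G n)) - dot (int_vec R k) (vG G).
    by rewrite !dotE !mxE; ring.
  by rewrite kpt /X mulrC divfK //; ring.
pose rs := [seq ce (X G n) | G <- s, n <- iota 0 (absz ki)].
have urs : uniq rs.
  apply: allpairs_uniq => //; first exact: iota_uniq.
  move=> [G n] [G' n'] /allpairsP[[G1 n1] /= [G1s n1i [-> ->]]].
  move=> /allpairsP[[G2 n2] /= [G2s n2i [-> ->]]] /= e.
  have GG : G1 = G2.
    have m1 := onG G1 n1 G1s; have m2 := onG G2 n2 G2s.
    rewrite (ptper _ _ e) in m1.
    have [e1 _] := vGP G1 G1s; have [e2 _] := vGP G2 G2s; rewrite e1 in m1.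
    have {}m2 : geodesic (vG G2) w (pi2 (pt (X G2 n2))) by rewrite -e2.
    by rewrite e1 e2; exact: geodesic_eq m1 m2.
  rewrite -GG in e *; congr (_, _).
  (* Parameters of the same point of the circle differ by an integer m, so n1 - n2 = m ki; as n1, n2
     < |ki|, this forces m = 0. *)
  have [m mE] := ce_inj e.
  have {}mE : (n1%:Z - n2%:Z)%:~R = (m * ki)%:~R :> R.
    rewrite intrM intrD mulrNz; apply: (mulIf (invr_neq0 kiR)).
    rewrite mulfK // -[RHS](addKr (X G1 n2)) -mE /X; field; exact: kiR.
  have {}mE : n1%:Z - n2%:Z = m * ki by apply/eqP; rewrite -(eqr_int R) mE.
  move: n1i n2i; rewrite !mem_iota !add0n /= => n1i n2i.
  have [m0|m0] := eqVneq m 0.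
    by move: mE; rewrite m0 mul0r => /eqP; rewrite subr_eq0 eqz_nat => /eqP.
  exfalso; have := congr1 absz mE; rewrite abszM => e'.
  have m1 : (0 < absz m)%N by rewrite absz_gt0.
  have : (absz ki <= absz m * absz ki)%N by rewrite leq_pmull.
  rewrite -e' leqNgt; move: n1i n2i; clear; case: (leqP n1 n2) => h n1i n2i.
    by rewrite distnEr // (leq_ltn_trans (leq_subr _ _) n2i).
  by rewrite distnEl ?(ltnW h) // (leq_ltn_trans (leq_subr _ _) n1i).
have rsq : all (root q) rs.
  apply/allP => _ /allpairsP[[G n] /= [Gs _ ->]]; apply/eqP/qz.
  by have [_ /(_ _ (onG G n Gs))[]] := vGP G Gs.
have := max_poly_roots q0 rsq urs; rewrite size_allpairs size_iota.
by move=> /leq_trans/(_ sq).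
Qed.

Lemma card_nodal_geodesics (s : seq (set (torus R))) : uniq s ->
  (forall G, G \in s -> nodal_geodesics G) ->
  (size s * maxn (absz (k 0%R ord0)) (absz (k 0%R ord_max)) <= 2 * M)%N.
Proof.
move=> us sG; have [F hF] := spectral_poly_exists hE hf.
have [sF sYF F0 FE] := hF.
(* The circles pass through a point where f does not vanish, so that F restricts to a nonzero
   polynomial on them. *)
have [_ [p fp] _] := hf; pose x0 := repr p 0 ord0; pose y0 := repr p 0 ord_max.
have Fp : F.[(ce y0)%:P].[ce x0] != 0.
  apply/eqP => /(spectral_zero hF); rewrite -lift_repr => fp0.
  by move: fp; rewrite fp0 eqxx.
(* The vertical circle is crossed |k_2| times and the horizontal one |k_1| times; the larger number,
   which is the height, gives the better bound. *)
have [kk|kk] := leqP (absz (k 0 ord0)) (absz (k 0 ord_max)).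
  have k1 : k 0 ord_max != 0.
    apply: contraNneq (primitive_neq0 pk) => k10; apply/eqP/rowP.
    apply: ord2_cases; rewrite mxE //.
    by move: kk; rewrite k10 leqn0 absz_eq0 => /eqP.
  apply: (@card_geodesics_on_curve (fun y => mk2 x0 y) (k 0 ord_max)
      ((k 0 ord0)%:~R * x0) (eval_inner (ce x0) F)) => //.
  - by move=> y; rewrite dotE !mxE /= addrC.
  - move=> y y' /ce_inj[n ->]; apply/pi_eq/int_latticeP; exists 0, n.
    by apply: row2P; rewrite !mxE /= ?subrr // addrAC subrr add0r.
  - move=> y; rewrite lift_pi mk2_0 mk2_1 => ph.
    by rewrite horner_eval_inner; apply/(spectral_zero hF).
  - by apply: contraNneq Fp => F00; rewrite -horner_eval_inner F00 horner0.
  - exact: leq_trans (size_poly _ _) sF.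
have k0 : k 0 ord0 != 0 by rewrite -absz_gt0 (leq_ltn_trans _ kk).
apply: (@card_geodesics_on_curve (fun x => mk2 x y0) (k 0 ord0)
    ((k 0 ord_max)%:~R * y0) F.[(ce y0)%:P]) => //.
- by move=> x; rewrite dotE !mxE.
- move=> x x' /ce_inj[n ->]; apply/pi_eq/int_latticeP; exists n, 0.
  by apply: row2P; rewrite !mxE /= ?subrr // addrAC subrr add0r.
- move=> x; rewrite lift_pi mk2_0 mk2_1 => ph.
  by apply/(spectral_zero hF).
- by apply: contraNneq Fp => ->; rewrite horner0.
- exact: leq_trans (max_size_evalC _ _) sYF.
Qed.

End NodalGeodesics.

Theorem theorem1p2 (R : realType) (zeta zeta_perp : 'rV[R]_2)
    (f : torus R -> R) (E : R)
    (hzeta : direction zeta) (hperp : direction zeta_perp)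
    (horth : dot zeta_perp zeta = 0)
    (hE : 0 < E) (hf : laplace_eigenfunction f E) :
  [/\ rational_direction zeta ->
        exists (Gs : set (set (torus R))) (P : set (torus R)),
          [/\ forall G, Gs G -> closed_geodesic_orthogonal zeta G,
              (counting Gs <= (Num.sqrt E / (pi * (height zeta)%:R))%:E)%E,
              P `<=` nonsingular_zeros f `\` \bigcup_(G in Gs) G,
              (counting P <= (2 / pi ^+ 2 * E)%:E)%E &
              exists2 S : set (torus R), S `<=` singular_zeros f &
                A_set zeta_perp f = \bigcup_(G in Gs) G `|` P `|` S],
      ~ rational_direction zeta ->
        exists P : set (torus R),
          [/\ P `<=` nonsingular_zeros f,
              (counting P <= (2 / pi ^+ 2 * E)%:E)%E &
              exists2 S : set (torus R), S `<=` singular_zeros f &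
                A_set zeta_perp f = P `|` S] &
      ~ (exists G : set (torus R),
           closed_geodesic G /\ G `<=` A_set zeta_perp f) ->
        (N_count zeta f <= (2 / pi ^+ 2 * E)%:E)%E].
Proof.
set w := zeta_perp.
have [F hF] := spectral_poly_exists hE hf.
have wn0 : w != 0 by rewrite -dot_eq0 (direction_dot hperp) oner_eq0.
have zn0 : zeta != 0 by rewrite -dot_eq0 (direction_dot hzeta) oner_eq0.
(* The integer vector orthogonal to [w] is parallel to zeta. *)
have irr x : on_line_component w F x -> rational_direction zeta.
  move=> /(line_component_rational hF)[k [k0 kw]]; split => //.
  have kn0 : int_vec R k != 0 by rewrite int_vec0.
  have [c ->] := orthogonal_parallel wn0 (etrans (dotC _ _) horth) kw kn0.
  by exists c, k.
have line x : on_line_component w F x ->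
    rational_direction w /\ geodesic (repr x) w `<=` A_set w f.
  move=> ox; split; last exact: (line_component_geodesic hf hF ox).
  exact: rational_perp hperp horth (irr x ox).
have mem_line x : geodesic (repr x) w x.
  by exists 0 => //; rewrite scale0r addr0 reprK.
split.
(* All geodesics in direction [w] inside [A_set] are taken, so a point off them cannot lie on a line
   component: the geodesic through it would be among them. *)
- move=> rz; exists (nodal_geodesics f w).
  exists [set x | [/\ A_set w f x, grad f x <> 0 &
    ~ (\bigcup_(G in nodal_geodesics f w) G) x]].
  split.
  + move=> G [v [-> _]]; exists v, w; split => //.
    exact: rational_perp hperp horth rz.
  + have [k [c [pk zk hk]]] := height_spec rz.
    have c0 : c != 0 by apply: contraNneq zn0 => c0; rewrite zk c0 scale0r.
    have kw : dot (int_vec R k) w = 0.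
      apply: (mulfI c0); rewrite mulr0 -horth zk !dotE !mxE; ring.
    have h0 : (0 < height zeta)%N.
      rewrite hk leq_max !absz_gt0 -negb_and; apply: contra (primitive_neq0 pk).
      by move=> /andP[/eqP k0 /eqP k1]; apply/eqP/rowP; apply: ord2_cases; rewrite mxE.
    apply: counting_le => s us sG.
    have := card_nodal_geodesics hE hf hperp pk kw us sG; rewrite -hk => sM.
    have p0 : 0 < pi :> R := pi_gt0 R.
    have hR : 0 < (height zeta)%:R :> R by rewrite ltr0n.
    rewrite ler_pdivlMr ?mulr_gt0 // mulrCA mulrC -ler_pdivlMr // -natrM.
    apply: le_trans (_ : (2 * maxfreq E)%:R <= _); first by rewrite ler_nat.
    by have := maxfreq_le E; rewrite natrM invfM mulrCA ler_pdivlMl.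
  + by move=> x [[fx _] gx nx]; split.
  + apply: counting_le => s us sP; apply: (@card_good_points _ _ _ w hE hf _ hF _ us)
    => x /sP[Ax gx nx].
    split => // ox; apply: nx; exists (geodesic (repr x) w); last exact: mem_line.
    by exists (repr x); split => //; have [] := line x ox.
  + exists [set x | A_set w f x /\ grad f x = 0].
      by move=> x [[fx _] gx].
    apply/seteqP; split => [x Ax|x [[[G [v [_ GA]] Gx]|[]//]|[]//]]; last exact: GA.
    have [gx|gx] := pselect (grad f x = 0); first by right.
    left; have [Gx|Gx] := pselect ((\bigcup_(G in nodal_geodesics f w) G) x);
      first by left.
    by right.
- move=> nrz; exists [set x | A_set w f x /\ grad f x <> 0]; split.
  + by move=> x [[fx _] gx].
  + apply: counting_le => s us sP; apply: (@card_good_points _ _ _ w hE hf _ hF _ us)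
    => x /sP[Ax gx].
    by split => // /irr.
  + exists [set x | A_set w f x /\ grad f x = 0].
      by move=> x [[fx _] gx].
    apply/seteqP; split => [x Ax|x [[]//|[]//]].
    by have [gx|gx] := pselect (grad f x = 0); [right|left].
(* A gradient along zeta is orthogonal to [w], so the counted points lie in [A_set]; a line
   component through one of them would produce an excluded closed geodesic. *)
- move=> noG; rewrite /N_count; apply: counting_le => s us sP.
  apply: (@card_good_points _ _ _ w hE hf _ hF _ us) => x /sP[fx gx gz]; split => //.
    split => //; have e0 : enorm (grad f x) != 0.
      apply/eqP => e0; apply: gx; apply/eqP; rewrite -dot_eq0.
      by rewrite -[dot _ _]sqr_sqrtr ?dot_ge0 // [Num.sqrt _]e0 expr0n.
    have orth c : dot (c *: zeta) w = 0.
      by rewrite -[RHS](mulr0 c) -horth !dotE !mxE; ring.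
    have -> : grad f x = enorm (grad f x) *: ((enorm (grad f x))^-1 *: grad f x).
      by rewrite scalerA mulfV // scale1r.
    by case: gz => ->; rewrite ?scalerN -?scaleNr orth.
  move=> ox; apply: noG; exists (geodesic (repr x) w); have [rw lA] := line x ox.
  by split => //; exists (repr x), w.
Qed.
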